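(* Let $K$ be a number field with ring of integers $\mathcal{O}_K$, let $\Gamma=\mathrm{GL}(2,\mathcal{O}_K)$, and let $\mathfrak{a},\mathfrak{b}$ be integral ideals of $\mathcal{O}_K$ with $\mathfrak{a}^2\mathfrak{b}=\langle\beta\rangle$ principal. Then there is a set of $\eta(\mathfrak{b})$ matrices $g_i$, all with determinant $\beta$, such that $$\widetilde{T}_{\mathfrak{a},\mathfrak{a}}\widetilde{T}_{\mathfrak{b}}(\mathcal{O}_K\oplus\mathcal{O}_K)=\sum_{i=1}^{\eta(\mathfrak{b})}(\mathcal{O}_K\oplus\mathcal{O}_K)g_i .$$ The number of $g_i$ is $\eta(\mathfrak{b})=\sum_{\mathfrak{b}=\mathfrak{b}_1\mathfrak{b}_2^2}\psi(\mathfrak{b}_1)$, where the sum is over all factorizations of $\mathfrak{b}$ of the form $\mathfrak{b}=\mathfrak{b}_1\mathfrak{b}_2^2$. For each such factorization, there are $\psi(\mathfrak{b}_1)$ matrices $g_i=BC$, where $B$ is a fixed $(\mathfrak{a}\mathfrak{b}_1\mathfrak{b}_2,\mathfrak{a}\mathfrak{b}_2)$-matrix with $\det(B)=\beta$ and $C$ runs through a set of (right) coset representatives with determinant $1$ of $\Gamma_0(\mathfrak{b}_1)$ in $\Gamma$. The collection of matrices $\{g_i\}$ normalises $\Gamma$, in the sense that there is a permutation $\sigma$ of $\{1,2,\dots,\eta(\mathfrak{b})\}$ such that $g_i\Gamma=\Gamma g_{\sigma(i)}$ for all $i$.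
   Context: All ideals are nonzero, and the ideals $\mathfrak{b}_1,\mathfrak{b}_2$ in the factorizations are integral. $\Gamma_0(\mathfrak{b}_1)$ is the subgroup of $\Gamma$ of matrices whose $(2,1)$-entry lies in $\mathfrak{b}_1$. $N(\mathfrak{a})=\#(\mathcal{O}_K/\mathfrak{a})$, $\psi(\mathfrak{b})=N(\mathfrak{b})\prod_{\mathfrak{p}\mid\mathfrak{b}}(1+N(\mathfrak{p})^{-1})$, and, for $\mathfrak{b}=\prod_{\mathfrak{p}}\mathfrak{p}^e$, $$\eta(\mathfrak{b})=\prod_{\mathfrak{p}\mid\mathfrak{b}}(1+N(\mathfrak{p})+N(\mathfrak{p})^2+\dots+N(\mathfrak{p})^e).$$ Elements of lattices are written as row vectors, with matrices acting on the right. For integral ideals $\mathfrak{c},\mathfrak{d}$ with $\mathfrak{c}\mathfrak{d}$ principal, a $(\mathfrak{c},\mathfrak{d})$-matrix is a matrix $M\in\mathrm{Mat}_2(\mathcal{O}_K)$ with $(\mathcal{O}_K\oplus\mathcal{O}_K)M=\mathfrak{c}\oplus\mathfrak{d}$. The operators act on formal $\mathbb{Q}$-linear combinations of lattices (here, full-rank $\mathcal{O}_K$-lattices in $K\oplus K$). For lattices $M\subseteq L$ with $L/M\cong\mathcal{O}_K/\mathfrak{a}_1\oplus\mathcal{O}_K/\mathfrak{a}_2$, the index ideal is $[L:M]=\mathfrak{a}_1\mathfrak{a}_2$. The operator $\widetilde{T}_{\mathfrak{b}}$ sends $L$ to the formal sum of all sublattices $M\subseteq L$ with $[L:M]=\mathfrak{b}$,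 and $\widetilde{T}_{\mathfrak{a},\mathfrak{a}}$ sends $L$ to $\mathfrak{a}L$. The general definitions of these operators also carry normalising scalar factors, $N(\mathfrak{b})$ and $N(\mathfrak{a})^2$ respectively; these are not written in the displayed identity.
   Formalization: The last claim, one permutation σ with g_iΓ = Γg_{σ(i)} for all i, is false as stated (K = ℚ, 𝔞 = (1), 𝔟 = (2)); proved instead: for each γ in Γ there is a permutation σ, depending on γ, with g_iγ in Γg_{σ(i)} for all i. *)

(* Defs.v *)
From HB Require Import structures.
From mathcomp Require Export all_boot all_order all_fingroup all_algebra all_field.
From mathcomp Require Export finmap.
From mathcomp Require Export boolp classical_sets functions cardinality fsbigop.
From mathcomp Require Export freeg.

Set Implicit Arguments.
Unset Strict Implicit.
Unset Printing Implicit Defensive.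

Import Order.TTheory GRing.Theory Num.Theory.

Local Open Scope classical_set_scope.
Local Open Scope ring_scope.

(* A number field is a finite extension of the rationals. Its ring of integers
   and its ideals are sets of elements of K. *)

Definition ring_of_integers (K : fieldExtType rat) : set K :=
  [set x | integralOver (intr : int -> K) x].

Notation "''O_' K" := (@ring_of_integers K)
  (at level 8, K at level 2, format "''O_' K").

Section Ideals.
Variable K : fieldExtType rat.
Implicit Types (a b p : set K) (x y : K).

(* The zero ideal is excluded. *)
Definition integral_ideal a : Prop :=
  [/\ a `<=` 'O_K, a 0,
      (forall x y, a x -> a y -> a (x + y)),
      (forall c x, 'O_K c -> a x -> a (c * x))
    & exists2 x, a x & x != 0].

Definition principal_ideal x : set K := [set c * x | c in 'O_K].

Definition idealM a b : set K :=
  [set x | exists (n : nat) (u v : 'I_n -> K),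
     [/\ forall i, a (u i), forall i, b (v i) & x = \sum_i u i * v i]].

Definition idealX a n : set K := iter n (idealM a) 'O_K.

Definition ideal_dvd a b : Prop := exists2 c, integral_ideal c & b = idealM a c.

(* The cosets of a in 'O_K are taken as subsets of K. *)
Definition ideal_norm a : nat :=
  #|` fset_set [set [set x + y | y in a] | x in 'O_K] |.

Definition prime_ideal p : Prop :=
  [/\ integral_ideal p, p <> 'O_K
    & forall x y, 'O_K x -> 'O_K y -> p (x * y) -> p x \/ p y].

Definition prime_divisors b : set (set K) :=
  [set p | prime_ideal p /\ ideal_dvd p b].

(* The exponent of p in the factorization of b: the e such that p^e divides b
   exactly. *)
Definition ideal_exponent p b : nat :=
  xget 0%N [set e | ideal_dvd (idealX p e) b /\ ~ ideal_dvd (idealX p e.+1) b].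

Definition psi b : rat :=
  (ideal_norm b)%:R *
  \big[*%R/1]_(p \in prime_divisors b) (1 + (ideal_norm p)%:R^-1 : rat).

Definition eta b : nat :=
  \big[muln/1%N]_(p \in prime_divisors b)
    (\sum_(k < (ideal_exponent p b).+1) ideal_norm p ^ k)%N.

(* The pairs (b1, b2) with b = b1 b2^2. *)
Definition sq_factorizations b : set (set K * set K) :=
  [set f | [/\ integral_ideal f.1, integral_ideal f.2
             & b = idealM f.1 (idealX f.2 2)]].

End Ideals.

Section Matrices.
Variable K : fieldExtType rat.
Implicit Types (a b : set K) (L : set 'rV[K]_2) (M : 'M[K]_2).

Definition integral_mx m n (M : 'M[K]_(m, n)) : Prop :=
  forall i j, 'O_K (M i j).

Definition GL2_integers : set 'M[K]_2 :=
  [set M | [/\ integral_mx M, M \in unitmx & integral_mx (invmx M)]].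

Definition Gamma0 b : set 'M[K]_2 :=
  [set M | GL2_integers M /\ b (M 1 0)].

Definition dsum a b : set 'rV[K]_2 :=
  [set v | a (v 0 0) /\ b (v 0 1)].

Definition latmul L M : set 'rV[K]_2 := [set v *m M | v in L].

Definition ideal_pair_mx (c d : set K) M : Prop :=
  integral_mx M /\ latmul (dsum 'O_K 'O_K) M = dsum c d.

(* G is the disjoint union of the cosets H c with c in C. *)
Definition right_coset_reps (H G C : set 'M[K]_2) : Prop :=
  C `<=` G /\
  forall M, G M -> exists! c, C c /\ [set h *m c | h in H] M.

End Matrices.

Arguments GL2_integers K : clear implicits.

Section Lattices.
Variable K : fieldExtType rat.
Implicit Types (a b : set K) (L M : set 'rV[K]_2).

(* The 'O_K-span of the rows of a matrix of rank 2. *)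
Definition is_lattice L : Prop :=
  exists (n : nat) (G : 'M[K]_(n, 2)),
    row_full G /\ L = [set w *m G | w in [set w : 'rV[K]_n | integral_mx w]].

(* L/M and X/Y are isomorphic 'O_K-modules, where M is a submodule of L and Y
   one of X: f picks a representative of the image of each class. *)
Definition quotient_isog (V W : lmodType K) (L M : set V) (X Y : set W) : Prop :=
  exists f : V -> W,
    [/\ forall v, L v -> X (f v),
        forall c u v, 'O_K c -> L u -> L v ->
          Y (f (c *: u + v) - (c *: f u + f v)),
        forall v, L v -> (Y (f v) <-> M v)
      & forall x, X x -> exists2 v, L v & Y (x - f v)].

(* [L : M] = b, with 'O_K/a1 (+) 'O_K/a2 written as the quotient of
   'O_K (+) 'O_K by a1 (+) a2. *)
Definition has_index_ideal L M b : Prop :=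
  exists a1 a2 : set K,
    [/\ integral_ideal a1, integral_ideal a2,
        quotient_isog L M (dsum 'O_K 'O_K) (dsum a1 a2)
      & b = idealM a1 a2].

Definition sublattices_of_index L b : set (set 'rV[K]_2) :=
  [set M | [/\ is_lattice M, M `<=` L & has_index_ideal L M b]].

Definition ideal_scale a L : set 'rV[K]_2 :=
  [set x | exists (n : nat) (u : 'I_n -> K) (v : 'I_n -> 'rV[K]_2),
     [/\ forall i, a (u i), forall i, L (v i) & x = \sum_i u i *: v i]].

(* Formal Q-linear combinations. The basis consists of all subsets of K (+) K,
   so the combinations of lattices form a subspace. *)
Definition formal_sum := {freeg (set 'rV[K]_2) / rat}.

Definition single L : formal_sum := << L >>.

(* The operators, extended linearly, without their normalising scalars. *)
Definition hecke_T b : formal_sum -> formal_sum :=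
  fglift (fun L => \sum_(M \in sublattices_of_index L b) single M).

Definition hecke_TT a : formal_sum -> formal_sum :=
  fglift (fun L => single (ideal_scale a L)).

End Lattices.

(* Main.v *)
(* Writing M = d M' with d the content of M, a sublattice of index b in
   'O_K (+) 'O_K becomes (b1 b2 (+) b2) g with b = b1 b2^2, b2 = d and g in
   GL(2, 'O_K): M' contains a unimodular vector, which is taken as a basis
   vector. Here b2 and the coset Gamma_0(b1) g are determined by M. Multiplying
   by a gives (a b1 b2 (+) a b2) g, and a matrix B with determinant beta and row
   lattice a b1 b2 (+) a b2 exists because the product of these two ideals is
   a^2 b = (beta). The index psi(b1) of Gamma_0(b1) is computed one prime at a
   time with explicit representatives, and the sum of psi(b1) over the
   factorizations satisfies the same recursion in the exponent of a prime as eta.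
   Right multiplication by GL(2, 'O_K) permutes the sublattices of index b, which
   gives the last assertion. The arithmetic of ideals rests on the finiteness of
   'O_K / a: n + 1 integers satisfy a primitive linear relation over Z, where
   n = [K : Q], so 'O_K / p has dimension at most n over F_p. *)
Require Import Defs.
From mathcomp Require Import ring zify.

Set Implicit Arguments.
Unset Strict Implicit.
Unset Printing Implicit Defensive.

Import Order.TTheory GRing.Theory Num.Theory.
Local Open Scope classical_set_scope.
Local Open Scope ring_scope.

(** * Ideal arithmetic *)

(** The definitions make ideals bare subsets of [K], so the theory of Dedekind domains is built
    here. Its keystone is invertibility, [idealM a (idealV a) = 'O_K], from which follow
    cancellation and the equivalence of containing and dividing. Inductions over ideals run on the
    norm. Localization and the Chinese remainder theorem are replaced by an avoidance lemma for
    modules: vectors that are good at each of finitely many primes separately can be combined into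
    one that is good at all of them.

    The obstacle on the lattice side is that [has_index_ideal] asserts some isomorphism of L/M with
    a sum ['O_K / a1 (+) 'O_K / a2], whereas the normal form of M produces its own pair b1 b2, b2.
    The two pairs may differ; only their products agree. This product is the Fitting ideal of L/M,
    and its invariance is what links the index to the factorization b = b1 b2^2. *)

Section RingOfIntegers.
Variable K : fieldExtType rat.
Implicit Types (a b p : set K) (x y z : K).

Lemma intO (z : int) : 'O_K (z%:~R : K).
Proof. exact: (@integral_id _ _ (intr : {rmorphism int -> K})). Qed.

Lemma O0 : 'O_K (0 : K). Proof. exact: (intO 0). Qed.
Lemma O1 : 'O_K (1 : K). Proof. exact: (intO 1). Qed.

Lemma OD x y : 'O_K x -> 'O_K y -> 'O_K (x + y).
Proof. exact: (@integral_add _ _ (intr : {rmorphism int -> K})). Qed.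

Lemma ON x : 'O_K x -> 'O_K (- x).
Proof. exact: (@integral_opp _ _ (intr : {rmorphism int -> K})). Qed.

Lemma OB x y : 'O_K x -> 'O_K y -> 'O_K (x - y).
Proof. by move=> xO yO; apply/OD/ON. Qed.

Lemma OM x y : 'O_K x -> 'O_K y -> 'O_K (x * y).
Proof. exact: (@integral_mul _ _ (intr : {rmorphism int -> K})). Qed.

Lemma OX x n : 'O_K x -> 'O_K (x ^+ n).
Proof. by move=> xO; elim: n => [|n IH]; [apply: O1 | rewrite exprS; apply: OM]. Qed.

Lemma Osum (I : Type) (r : seq I) (P : pred I) (F : I -> K) :
  (forall i, P i -> 'O_K (F i)) -> 'O_K (\sum_(i <- r | P i) F i).
Proof. by move=> FO; elim/big_ind: _ => //; [apply: O0 | apply: OD]. Qed.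

(** Transitivity of integrality: the coefficients may be integral elements instead of integers. *)
Lemma monic_root_O x (q : {poly K}) :
  q \is monic -> root q x -> (forall i, 'O_K q`_i) -> 'O_K x.
Proof.
move=> qm qx qO.
apply: (@integral_root_monic _ _ (intr : {rmorphism int -> K}) _ _ qm qx).
exact/(integral_poly (intr : {rmorphism int -> K})).
Qed.

Definition Omodule a :=
  [/\ a 0, (forall x y, a x -> a y -> a (x + y))
    & (forall c x, 'O_K c -> a x -> a (c * x))].

Lemma ideal_Omod a : integral_ideal a -> Omodule a.
Proof. by case. Qed.

Lemma Omod_O : Omodule ('O_K : set K).
Proof. by split; [apply: O0 | apply: OD | apply: OM]. Qed.

Lemma Omod0 a : Omodule a -> a 0. Proof. by case. Qed.

Lemma OmodD a x y : Omodule a -> a x -> a y -> a (x + y).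
Proof. by case=> _ + _; apply. Qed.

Lemma OmodM a c x : Omodule a -> 'O_K c -> a x -> a (c * x).
Proof. by case=> _ _; apply. Qed.

Lemma OmodN a x : Omodule a -> a x -> a (- x).
Proof. by move=> am ax; rewrite -mulN1r; apply: OmodM => //; apply/ON/O1. Qed.

Lemma OmodB a x y : Omodule a -> a x -> a y -> a (x - y).
Proof. by move=> am ax ay; apply: OmodD => //; apply: OmodN. Qed.

Lemma Omod_sum a (I : Type) (r : seq I) (P : pred I) (F : I -> K) :
  Omodule a -> (forall i, P i -> a (F i)) -> a (\sum_(i <- r | P i) F i).
Proof.
move=> am Fa; elim/big_ind: _ => //; first exact: Omod0.
by move=> x y ax ay; apply: OmodD.
Qed.

Lemma idealM_mem a b x y : a x -> b y -> idealM a b (x * y).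
Proof.
move=> ax bx; exists 1%N, (fun=> x), (fun=> y); split=> //.
by rewrite big_ord1.
Qed.

Lemma idealM0 a b : idealM a b 0.
Proof.
exists 0%N, (fun=> 0), (fun=> 0); split=> [[]|[]|] //.
by rewrite big_ord0.
Qed.

Lemma idealMD a b x y : idealM a b x -> idealM a b y -> idealM a b (x + y).
Proof.
move=> [n [u [v [ua vb ->]]]] [m [u' [v' [ua' vb' ->]]]].
exists (n + m)%N,
  (fun i => match fintype.split i with inl j => u j | inr j => u' j end),
  (fun i => match fintype.split i with inl j => v j | inr j => v' j end).
split=> [i|i|]; try by case: fintype.split.
rewrite big_split_ord /=; congr (_ + _); apply: eq_bigr => i _.
  by have := @unsplitK n m (inl i) => /= ->.
by have := @unsplitK n m (inr i) => /= ->.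
Qed.

(** Used as an induction principle: with a property of elements in the place of [c], it reduces a
    claim on a product of ideals to 0, sums and single products. *)
Lemma idealM_sub a b c : c 0 -> (forall x y, c x -> c y -> c (x + y)) ->
  (forall x y, a x -> b y -> c (x * y)) -> idealM a b `<=` c.
Proof.
move=> c0 cD cM x [n [u [v [ua vb ->]]]].
by elim/big_ind: _ => // i _; apply: cM.
Qed.

Lemma idealM_subO a b c : Omodule c ->
  (forall x y, a x -> b y -> c (x * y)) -> idealM a b `<=` c.
Proof. by case=> c0 cD _; apply: idealM_sub. Qed.

Lemma idealMC a b : idealM a b = idealM b a.
Proof.
suff sub a' b' : idealM a' b' `<=` idealM b' a' by apply/seteqP; split; apply: sub.
apply: idealM_sub; [exact: idealM0 | exact: idealMD|].
by move=> x y ax bY; rewrite mulrC; apply: idealM_mem.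
Qed.

Lemma idealMS a a' b b' : a `<=` a' -> b `<=` b' -> idealM a b `<=` idealM a' b'.
Proof.
move=> sa sb; apply: idealM_sub; [exact: idealM0 | exact: idealMD|].
by move=> x y ax bY; apply: idealM_mem; [apply: sa | apply: sb].
Qed.

Lemma idealMA a b c : idealM a (idealM b c) = idealM (idealM a b) c.
Proof.
have sub a' b' c' : idealM a' (idealM b' c') `<=` idealM (idealM a' b') c'.
  apply: idealM_sub; [exact: idealM0 | exact: idealMD|] => x y ax.
  move: y; apply: (@idealM_sub _ _ (fun y => idealM (idealM a' b') c' (x * y))).
  - by rewrite mulr0; apply: idealM0.
  - by move=> y z; rewrite mulrDr; apply: idealMD.
  - by move=> y z bY cz; rewrite mulrA; apply: idealM_mem => //; apply: idealM_mem.
apply/seteqP; split; first exact: sub.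
by rewrite idealMC (idealMC a b) (idealMC a (idealM b c)) (idealMC b c); apply: sub.
Qed.

Lemma idealMCA a b c : idealM a (idealM b c) = idealM b (idealM a c).
Proof. by rewrite !idealMA (idealMC a). Qed.

Lemma idealMACA a b c d :
  idealM (idealM a b) (idealM c d) = idealM (idealM a c) (idealM b d).
Proof. by rewrite -!idealMA (idealMCA b). Qed.

Lemma idealM_Omod a b : Omodule a -> Omodule (idealM a b).
Proof.
move=> am; split; [exact: idealM0 | exact: idealMD|] => c x cO.
move: x; apply: (@idealM_sub _ _ (fun y => idealM a b (c * y))).
- by rewrite mulr0; apply: idealM0.
- by move=> y z; rewrite mulrDr; apply: idealMD.
- by move=> y z ay bz; rewrite mulrA; apply: idealM_mem => //; apply: OmodM.
Qed.

Lemma idealM1 a : Omodule a -> idealM a 'O_K = a.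
Proof.
move=> am; apply/seteqP; split.
  by apply: idealM_subO => // x y ax yO; rewrite mulrC; apply: OmodM.
by move=> x ax; rewrite -[x]mulr1; apply: idealM_mem => //; apply: O1.
Qed.

Lemma ideal1M a : Omodule a -> idealM 'O_K a = a.
Proof. by move=> am; rewrite idealMC idealM1. Qed.

Lemma integral_idealO : integral_ideal ('O_K : set K).
Proof. by split=> //; [exact: O0 | exact: OD | exact: OM | exists 1; [exact: O1 | exact: oner_neq0]]. Qed.

Lemma ideal_O a x : integral_ideal a -> a x -> 'O_K x.
Proof. by case=> + _ _ _ _; apply. Qed.

Lemma idealI a : Omodule a -> a `<=` 'O_K -> (exists2 x, a x & x != 0) -> integral_ideal a.
Proof. by case. Qed.

Lemma idealM_ideal a b : integral_ideal a -> integral_ideal b -> integral_ideal (idealM a b).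
Proof.
move=> ai bi; apply: idealI; first exact/idealM_Omod/ideal_Omod.
  by apply: idealM_subO Omod_O _ => x y ax bY; apply: OM; [apply: ideal_O ax | apply: ideal_O bY].
case: ai => _ _ _ _ [x ax x0]; case: bi => _ _ _ _ [y bY y0].
by exists (x * y); [apply: idealM_mem | rewrite mulf_neq0].
Qed.

Lemma idealX2 a : Omodule a -> idealX a 2 = idealM a a.
Proof. by move=> am; rewrite /idealX /= idealM1. Qed.

Lemma idealXS a n : idealX a n.+1 = idealM a (idealX a n).
Proof. by []. Qed.

Lemma idealX_ideal a n : integral_ideal a -> integral_ideal (idealX a n).
Proof. by move=> ai; elim: n => [|n IH]; [exact: integral_idealO | exact: idealM_ideal]. Qed.

Lemma idealM_subl a b : integral_ideal a -> integral_ideal b -> idealM a b `<=` a.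
Proof.
move=> ai bi; apply: idealM_subO; first exact: ideal_Omod.
move=> x y ax bY; rewrite mulrC; apply: OmodM => //; first exact: ideal_Omod.
exact: ideal_O bY.
Qed.

Lemma idealM_subr a b : integral_ideal a -> integral_ideal b -> idealM a b `<=` b.
Proof. by move=> ai bi; rewrite idealMC; apply: idealM_subl. Qed.

Lemma ideal_eqO a : integral_ideal a -> a 1 -> a = 'O_K.
Proof.
move=> ai a1; apply/seteqP; split=> [x|x xO]; first exact: ideal_O.
by rewrite -[x]mulr1; apply: OmodM => //; apply: ideal_Omod.
Qed.

Lemma principal_Omod x : Omodule (principal_ideal x).
Proof.
split.
- by exists 0; [exact: O0 | rewrite mul0r].
- by move=> _ _ [c cO <-] [d dO <-]; exists (c + d); [exact: OD | rewrite mulrDl].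
- by move=> c _ cO [d dO <-]; exists (c * d); [exact: OM | rewrite mulrA].
Qed.

Lemma principal_mem x : principal_ideal x x.
Proof. by exists 1; [exact: O1 | rewrite mul1r]. Qed.

Lemma principal_ideal_ideal x : 'O_K x -> x != 0 -> integral_ideal (principal_ideal x).
Proof.
move=> xO x0; apply: idealI; first exact: principal_Omod.
  by move=> _ [c cO <-]; apply: OM.
by exists x => //; exact: principal_mem.
Qed.

Lemma principalP x y : x != 0 -> principal_ideal x y <-> 'O_K (y / x).
Proof.
move=> x0; split; first by case=> c cO <-; rewrite mulfK.
by move=> yO; exists (y / x) => //; rewrite divfK.
Qed.

Lemma idealM_principal x y :
  idealM (principal_ideal x) (principal_ideal y) = principal_ideal (x * y).
Proof.
apply/seteqP; split.
  apply: idealM_subO; first exact: principal_Omod.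
  move=> _ _ [c cO <-] [d dO <-]; exists (c * d); [exact: OM | ring].
move=> _ [c cO <-]; rewrite mulrA; apply: idealM_mem; last exact: principal_mem.
by exists c.
Qed.

Lemma idealM_principalE a x : Omodule a ->
  idealM (principal_ideal x) a = [set x * y | y in a].
Proof.
move=> am; apply/seteqP; split.
  apply: idealM_sub.
  - by exists 0; [exact: Omod0 | rewrite mulr0].
  - by move=> _ _ [y ay <-] [z az <-]; exists (y + z); [exact: OmodD | rewrite mulrDr].
  - move=> _ y [c cO <-] ay; exists (c * y); [exact: OmodM | ring].
by move=> _ [y ay <-]; apply: idealM_mem => //; exact: principal_mem.
Qed.

End RingOfIntegers.

(** * Finiteness of residue rings *)

Section Finiteness.
Variable K : fieldExtType rat.
Implicit Types (a b p : set K) (x y z : K).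

Lemma intK_eq0 (z : int) : ((z%:~R : K) == 0) = (z == 0).
Proof.
have -> : (z%:~R : K) = (z%:~R : rat)%:A by rewrite scaler_int.
by rewrite scaler_eq0 oner_eq0 orbF intr_eq0.
Qed.

(** More than [[K : Q]] elements are dependent over Q, and the product of the denominators clears a
    rational relation. *)
Lemma int_relation (n : nat) (X : 'I_n -> K) : (\dim {:K} < n)%N ->
  exists c : 'I_n -> int, (exists i, c i != 0) /\ \sum_i (c i)%:~R * X i = 0.
Proof.
move=> ltn.
have /negP nfree : ~~ free [tuple X i | i < n].
  apply/negP => /eqP; rewrite size_tuple => dimn.
  by have := dimvS (subvf <<[tuple X i | i < n]>>%VS); rewrite dimn leqNgt ltn.
have [k ksum [i0 ki0]] : exists2 k : 'I_n -> rat,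
    \sum_i k i *: X i = 0 & exists i, k i != 0.
  apply: contrapT => no; apply: nfree; apply/freeP => k ksum i.
  apply: contrapT => /eqP ki; apply: no; exists k; last by exists i.
  by rewrite -[RHS]ksum; apply: eq_bigr => j _; rewrite -tnth_nth tnth_mktuple.
pose D := \prod_i denq (k i).
have D0 : D != 0 by apply/prodf_neq0 => i _; apply: denq_neq0.
have kD i : k i * D%:~R = (numq (k i) * \prod_(j | j != i) denq (k j))%:~R.
  rewrite /D (bigD1 i) //= !rmorphM /= mulrA; congr (_ * _).
  by rewrite -{1}[k i]divq_num_den divfK // intr_eq0 denq_neq0.
exists (fun i => numq (k i) * \prod_(j | j != i) denq (k j)); split.
  exists i0; apply: contraNneq ki0 => c0; have /eqP := kD i0.
  by rewrite c0 mulf_eq0 intr_eq0 (negPf D0) orbF.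
have -> : \sum_i (numq (k i) * \prod_(j | j != i) denq (k j))%:~R * X i
   = D%:~R *: (\sum_i k i *: X i).
  rewrite scaler_sumr; apply: eq_bigr => i _.
  by rewrite scalerA mulrC [in RHS]mulrC kD scaler_int mulrC mulrzl.
by rewrite ksum scaler0.
Qed.

(* Dividing a relation by q as often as possible. *)
Lemma primitive_int_relation (n : nat) (X : 'I_n -> K) (q : nat) :
  (\dim {:K} < n)%N -> (1 < q)%N ->
  exists c : 'I_n -> int, (exists i, ~~ (q %| `|c i|)%N) /\ \sum_i (c i)%:~R * X i = 0.
Proof.
move=> ltn q1; have [c [cn0 cX]] := int_relation X ltn.
move: {2}(\sum_i `|c i|)%N.+1 (ltnSn (\sum_i `|c i|)%N) => N.
elim: N c cn0 cX => // N IH c cn0 cX leN.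
have [/existsP[i ci]|/existsPn cq] := boolP [exists i, ~~ (q %| `|c i|)%N].
  by exists c; split => //; exists i.
have cE i : c i = (c i %/ q)%Z * q by rewrite divzK //; apply/negPn/(cq i).
pose d i := (c i %/ q)%Z.
have q0 : (q%:Z : int) != 0 by lia.
have cd i : c i = d i * q by rewrite cE.
apply: (IH d).
- case: cn0 => i ci; exists i; apply: contraNneq ci => di.
  by rewrite cd di mul0r.
- have /eqP : (q%:~R : K) * \sum_i (d i)%:~R * X i = 0.
    by rewrite -[RHS]cX mulr_sumr; apply: eq_bigr => i _; rewrite cd rmorphM /= mulrCA mulrA.
  rewrite mulf_eq0 intK_eq0 (negPf q0) /=; exact: eqP.
(* The sum of the absolute values is the descent measure; a nonzero relation makes it positive, so
   division by q > 1 lowers it. *)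
- have -> : (\sum_i `|d i|)%N = ((\sum_i `|c i|) %/ q)%N.
    under [in RHS]eq_bigr => i _ do rewrite cd abszM absz_nat.
    by rewrite -big_distrl /= mulnK // ltnW.
  case: cn0 => i ci.
  have : (0 < \sum_i `|c i|)%N by rewrite (bigD1 i) //= addn_gt0 absz_gt0 ci.
  move=> /(ltn_Pdiv q1); lia.
Qed.

Definition finite_quotient a := exists s : seq K,
  (forall x, x \in s -> 'O_K x) /\ forall x, 'O_K x -> exists2 y, y \in s & a (x - y).

(* A maximal F_q-independent family in 'O_K / q has at most [K : Q] members and
   spans 'O_K / q. *)
Lemma finite_quotient_prime (q : nat) : prime q ->
  finite_quotient (principal_ideal (q%:R : K)).
Proof.
move=> qp; have q1 := prime_gt1 qp; pose I := principal_ideal (q%:R : K).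
have Im : Omodule I by exact: principal_Omod.
(* Independence over F_q, phrased with integer coefficients: a relation modulo q may only have
   multiples of q as coefficients. *)
pose indep n := exists2 X : 'I_n -> K, (forall i, 'O_K (X i)) &
  forall c : 'I_n -> int, I (\sum_i (c i)%:~R * X i) -> forall i, (q %| `|c i|)%N.
have ind0 : indep 0%N by exists (fun=> 0) => [[]|c _ []].
have ind_le n : indep n -> (n <= \dim {:K})%N.
  move=> [X XO Xi]; rewrite leqNgt; apply/negP => ltn.
  have [c [[i ci] cX]] := primitive_int_relation X ltn q1.
  by move/negP: ci; apply; apply: (Xi c); rewrite cX; exact: Omod0.
have exn : exists n, `[< indep n >] by exists 0%N; apply/asboolP.
have [n /asboolP[X XO Xi] nmax] :=
  @ex_maxnP (fun n => `[< indep n >]) _ exn (fun n h => ind_le n (asboolP _ h)).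
pose F (t : {ffun 'I_n -> 'I_q}) := \sum_i (t i)%:R * X i.
exists [seq F t | t <- enum {: {ffun 'I_n -> 'I_q}}]; split.
  move=> _ /mapP[t _ ->]; apply: Osum => i _; apply: OM => //; exact: (intO K (t i)).
move=> x xO.
(* By maximality of [n], adjoining x to the family [X] creates a relation modulo q with some
   coefficient prime to q. *)
pose Y (i : 'I_n.+1) := if unlift ord0 i is Some j then X j else x.
have [c cI [i0 ci0]] : exists2 c : 'I_n.+1 -> int,
    I (\sum_i (c i)%:~R * Y i) & exists i, ~~ (q %| `|c i|)%N.
  apply: contrapT => no; suff /asboolP /nmax : indep n.+1 by rewrite ltnn.
  exists Y => [i|c cI i]; first by rewrite /Y; case: unliftP.
  by apply: contrapT => /negP ci; apply: no; exists c => //; exists i.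
have YE : \sum_i (c i)%:~R * Y i =
    (c ord0)%:~R * x + \sum_i (c (fintype.lift ord0 i))%:~R * X i.
  rewrite big_ord_recl /Y unlift_none; congr (_ + _).
  by apply: eq_bigr => i _; rewrite liftK.
rewrite YE in cI.
have IqM z : 'O_K z -> I (q%:R * z).
  by move=> zO; exists z => //; rewrite mulrC.
(* Were the coefficient of x divisible by q, the remaining terms would be a relation among the [X],
   forcing all coefficients to be divisible by q. *)
have c0 : ~~ (q %| `|c ord0|)%N.
  apply/negP => qc; have /dvdzP[k ck] : (q%:Z %| c ord0)%Z by [].
  have : I (\sum_i (c (fintype.lift ord0 i))%:~R * X i).
    rewrite -[X in I X](addKr ((c ord0)%:~R * x)) ; apply: OmodD => //; apply: OmodN => //.
    rewrite ck rmorphM /= mulrAC mulrC; apply: IqM; apply: OM => //; exact: intO.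
  move=> /(Xi (fun i => c (fintype.lift ord0 i))) H.
  by move: ci0; case: (unliftP ord0 i0) => [j ->|->]; rewrite ?H ?qc.
have [u [v uv]] : exists u, exists v, u * c ord0 + v * q%:Z = 1.
  have /coprimezP[[u v] /= uv] : coprimez (c ord0) q%:Z.
    by rewrite /coprimez /gcdz /= gcdnC; have := prime_coprime `|c ord0| qp; rewrite c0 => /eqP->.
  by exists u, v.
(* As u inverts [c ord0] modulo q, x is congruent to the sum of the [e i * X i]; the [e i] are then
   reduced modulo q. *)
pose e i := - u * c (fintype.lift ord0 i).
have eq_lt i : (`|(e i %% q)%Z| < q)%N.
  have q0 : (q%:Z : int) != 0 by lia.
  have := modz_ge0 (e i) q0; have := ltz_mod (e i) q0; lia.
exists (F [ffun i => Ordinal (eq_lt i)]); first by apply/map_f; rewrite mem_enum.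
have q0 : (q%:Z : int) != 0 by lia.
have FE : F [ffun i => Ordinal (eq_lt i)] =
    - u%:~R * (\sum_i (c (fintype.lift ord0 i))%:~R * X i)
    - q%:R * (\sum_i (e i %/ q)%Z%:~R * X i).
  rewrite !mulr_sumr -sumrB; apply: eq_bigr => i _.
  rewrite ffunE /= -[_%:R]/((`|(e i %% q)%Z|%N%:Z)%:~R) (gez0_abs (modz_ge0 (e i) q0)).
  have -> : (e i %% q)%Z%:~R = (e i)%:~R - (e i %/ q)%Z%:~R * q%:R :> K.
    have eE : (e i)%:~R = (e i %/ q)%Z%:~R * q%:R + (e i %% q)%Z%:~R :> K.
      by rewrite {1}(divz_eq (e i) q) rmorphD rmorphM.
    by rewrite eE; ring.
  by rewrite /e rmorphM rmorphN /=; ring.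
have uv1 : u%:~R * (c ord0)%:~R + v%:~R * q%:R = 1 :> K.
  by rewrite -[RHS](rmorph1 (intr : {rmorphism int -> K})) -uv rmorphD !rmorphM.
have -> : x - F [ffun i => Ordinal (eq_lt i)] =
   u%:~R * ((c ord0)%:~R * x + \sum_i (c (fintype.lift ord0 i))%:~R * X i)
   + q%:R * (v%:~R * x + \sum_i (e i %/ q)%Z%:~R * X i).
  have xE : x = (u%:~R * (c ord0)%:~R + v%:~R * q%:R) * x by rewrite uv1 mul1r.
  by rewrite {1}xE FE; ring.
apply: OmodD => //; first by apply: OmodM => //; exact: intO.
apply: IqM; apply: OD; first by apply: OM => //; exact: intO.
by apply: Osum => i _; apply: OM => //; exact: intO.
Qed.

(** With m = k q for a prime q, ['O_K / m] is an extension of ['O_K / k] by [k 'O_K / m], a copy of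
    ['O_K / q]; hence the representatives [x + k y]. *)
Lemma finite_quotient_nat (m : nat) : (0 < m)%N ->
  finite_quotient (principal_ideal (m%:R : K)).
Proof.
elim/ltn_ind: m => m IH m0.
have [m1|m1] := leqP m 1.
  have -> : m = 1%N by lia.
  exists [:: 0]; split=> [x|x xO]; first by rewrite inE => /eqP->; exact: O0.
  exists 0; rewrite ?inE //; exists x => //; ring.
have qp := pdiv_prime m1; set q := pdiv m in qp.
have /dvdnP[k mE] : (q %| m)%N by exact: pdiv_dvd.
have k0 : (0 < k)%N by lia.
have /IH/(_ k0)[s [sO sP]] : (k < m)%N by have := prime_gt1 qp; nia.
have [t [tO tP]] := finite_quotient_prime qp.
exists [seq x + k%:R * y | x <- s, y <- t]; split.
  move=> _ /allpairsP[[x y] [/= xs yt ->]]; apply: OD; first exact: sO.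
  by apply: OM; [exact: (intO K k) | exact: tO].
move=> x xO; have [y ys [z zO zE]] := sP _ xO; have [w wt [u uO uE]] := tP _ zO.
exists (y + k%:R * w); first by apply/allpairsP; exists (y, w).
exists u => //; rewrite mE natrM opprD addrA -zE; move/eqP: uE.
by rewrite eq_sym subr_eq => /eqP->; ring.
Qed.

Lemma finite_quotientS a b : a `<=` b -> finite_quotient a -> finite_quotient b.
Proof.
move=> sub [s [sO sP]]; exists s; split=> // x /sP[y ys axy].
by exists y => //; apply: sub.
Qed.

(* The constant coefficient of an integer polynomial of least degree vanishing
   at an element of the ideal. *)
Lemma ideal_nat a : integral_ideal a -> exists2 m : nat, (0 < m)%N & a (m%:R : K).
Proof.
move=> ai; case: (ai) => aO _ _ _ [x ax x0]; have am := ideal_Omod ai.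
have xO := aO _ ax.
have [p pn0 px] : exists2 p : {poly int}, p != 0 & root (map_poly intr p) x.
  by case: xO => p pm px; exists p => //; apply: monic_neq0.
move: {2}(size p) (leqnn (size p)) => n; elim: n p pn0 px => [|n IH] p pn0 px.
  by rewrite leqn0 size_poly_eq0 (negPf pn0).
move=> sn; have [p0|p0] := eqVneq p`_0 0.
  have [r pE] : exists r, p = r * 'X.
    exists (Poly (behead p)); apply/polyP => -[|i]; rewrite coefMX //= coef_Poly.
    by rewrite nth_behead.
  have r0 : r != 0 by apply: contraNneq pn0 => r0; rewrite pE r0 mul0r.
  apply: (IH r) => //; last by move: sn; rewrite pE size_mulX.
  move: px; rewrite pE rmorphM /= map_polyX rootM => /orP[//|].
  by rewrite /root hornerX (negPf x0).
have [r pE] : exists r, p = r * 'X + (p`_0)%:P.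
  exists (Poly (behead p)); apply/polyP => -[|i]; rewrite coefD coefMX coefC //= ?add0r //.
  by rewrite addr0 coef_Poly nth_behead.
move: (p`_0) p0 pE => d d0 pE.
have rO : 'O_K (map_poly intr r).[x].
  rewrite horner_coef; apply: Osum => i _; apply: OM; last exact: OX.
  by rewrite coef_map; apply: intO.
have ad : a (d)%:~R.
  move: px; rewrite pE /root rmorphD rmorphM /= map_polyX map_polyC /= !hornerE => /eqP h.
  have -> : (d)%:~R = - ((map_poly intr r).[x] * x).
    by apply/eqP; rewrite -addr_eq0 addrC h.
  by apply: OmodN => //; apply: OmodM.
exists `|d|%N; first by rewrite absz_gt0.
rewrite -[_%:R]/((`|d|%N%:Z)%:~R) abszE normrEsign rmorphM /= .
by apply: OmodM => //; rewrite rmorph_sign; apply: OX; apply/ON/O1.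
Qed.

Lemma finite_quotient_ideal a : integral_ideal a -> finite_quotient a.
Proof.
move=> ai; have [m m0 am] := ideal_nat ai.
apply: finite_quotientS (finite_quotient_nat m0) => _ [c cO <-].
by apply: OmodM => //; exact: ideal_Omod.
Qed.

End Finiteness.

(** * Norms, prime ideals and invertibility *)

Section Norm.
Variable K : fieldExtType rat.
Implicit Types (a b p : set K) (x y z : K).

Definition transversal (T : finType) (M N : set K) (r : T -> K) :=
  [/\ forall i, M (r i), forall i j, N (r i - r j) -> i = j
    & forall x, M x -> exists i, N (x - r i)].

Definition coset a x : set K := [set x + y | y in a].

Lemma coset_eq a x y : Omodule a -> coset a x = coset a y <-> a (x - y).
Proof.
move=> am; split=> [xy|axy].
  have : coset a x x by exists 0; [exact: Omod0 | rewrite addr0].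
  by rewrite xy => -[z az <-]; rewrite addrC addKr.
apply/seteqP; split=> _ [z az <-].
  by exists (x - y + z); [exact: OmodD | ring].
exists (z - (x - y)); [exact: OmodB | ring].
Qed.

Lemma finite_cosets a : Omodule a -> finite_quotient a ->
  finite_set [set coset a x | x in 'O_K].
Proof.
move=> am [s [sO sP]]; apply: (@sub_finite_set _ _ (coset a @` [set` s])).
  by move=> _ [x xO <-]; have [y ys /(coset_eq _ _ am)] := sP _ xO; exists y.
exact/finite_image/finite_seq.
Qed.

Lemma norm_transversal a : integral_ideal a ->
  exists r : 'I_(ideal_norm a) -> K, transversal 'O_K a r.
Proof.
move=> ai; have am := ideal_Omod ai.
have fin := finite_cosets am (finite_quotient_ideal ai).
pose F := fset_set [set coset a x | x in 'O_K].
have inF A : (A \in F) <-> exists2 x, 'O_K x & coset a x = A.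
  by rewrite in_fset_set // inE.
have nthF (i : 'I_(ideal_norm a)) : nth set0 F i \in F by apply: mem_nth.
have ex (i : 'I_(ideal_norm a)) : exists x, 'O_K x /\ coset a x = nth set0 F i.
  by have /inF[x xO xE] := nthF i; exists x.
pose r i := projT1 (cid (ex i)).
have rE i : coset a (r i) = nth set0 F i by rewrite /r; case: cid => x [].
exists r; split=> [i|i j /(coset_eq _ _ am)|x xO].
- by rewrite /r; case: cid => x [].
- rewrite !rE => /eqP; rewrite nth_uniq ?fset_uniq // => /eqP.
  exact: val_inj.
- have /(nthP set0)[i ltin iE] : coset a x \in F by apply/inF; exists x.
  by exists (Ordinal ltin); apply/coset_eq => //; rewrite rE iE.
Qed.

Lemma norm_card (T : finType) a (r : T -> K) : Omodule a -> transversal 'O_K a r ->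
  ideal_norm a = #|T|.
Proof.
move=> am [rO rinj rsurj]; apply: card_fset_set.
have -> : [set [set x + y | y in a] | x in 'O_K] = [set coset a (r i) | i in [set: T]].
  apply/seteqP; split=> [_ [x xO <-]|_ [i _ <-]]; last by exists (r i).
  by have [i ai] := rsurj x xO; exists i => //; apply/coset_eq => //; rewrite -opprB; apply: OmodN.
have /card_eq_trans -> // : ([set coset a (r i) | i in [set: T]] #= [set: T])%card.
  apply: inj_card_eq => i j _ _ /(coset_eq _ _ am); exact: rinj.
have := inj_card_eq (A := [set: T]) (f := @enum_rank T).
have -> : [set enum_rank x | x in [set: T]] = [set: 'I_#|T|].
  by apply/seteqP; split=> // i _; exists (enum_val i) => //; rewrite enum_valK.
move=> h; rewrite card_eq_sym; apply: card_eq_trans (h _); first exact: card_II.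
by move=> i j _ _; exact: enum_rank_inj.
Qed.

Lemma ideal_norm_gt0 a : integral_ideal a -> (0 < ideal_norm a)%N.
Proof.
move=> /norm_transversal[r [_ _ /(_ 0 (O0 K))[i _]]]; exact: leq_ltn_trans (ltn_ord i).
Qed.

(** The measure of the inductions over ideals. Representatives modulo [b] inject into the classes
    modulo [a]; were this map [g] onto, an x in [b] outside [a] and 0 would share a class modulo
    [a], because they share one modulo [b]. *)
Lemma ideal_norm_lt a b : integral_ideal a -> integral_ideal b ->
  a `<=` b -> a <> b -> (ideal_norm b < ideal_norm a)%N.
Proof.
move=> ai bi sub neq; have am := ideal_Omod ai; have bm := ideal_Omod bi.
have [r [rO rinj rsurj]] := norm_transversal ai.
have [s [sO sinj ssurj]] := norm_transversal bi.
have [g gP] := choice (fun j => rsurj _ (sO j)).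
have gb i j : b (s i - s j) -> i = j by exact: sinj.
have ginj : injective g.
  move=> i j gij; apply: gb; have -> : s i - s j = (s i - r (g i)) - (s j - r (g j)).
    by rewrite gij; ring.
  by apply: OmodB => //; apply: sub.
have [x bx nax] : exists2 x, b x & ~ a x.
  apply: contrapT => no; apply: neq; apply/seteqP; split=> // x bx.
  by apply: contrapT => nax; apply: no; exists x.
rewrite ltn_neqAle; apply/andP; split; last first.
  by have := leq_card g ginj; rewrite !card_ord.
apply/eqP => nn.
have gbij : bijective g by apply: inj_card_bij => //; rewrite !card_ord nn.
have [i ai0] := rsurj _ (ideal_O bi bx).
have [i0 ai00] := rsurj _ (O0 K).
case: gbij => h hg gh.
have ii0 : i = i0.
  rewrite -(gh i) -(gh i0); congr g; apply: gb.
  have bh k : b (s (h k) - r k) by rewrite -{2}(gh k); exact/sub/gP.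
  have -> : s (h i) - s (h i0) = (s (h i) - r i) - (s (h i0) - r i0)
     - ((x - r i) - (0 - r i0)) + x by ring.
  have bxr : b ((x - r i) - (0 - r i0)) by apply: sub; exact: OmodB.
  by apply: OmodD => //; apply: OmodB => //; exact: OmodB.
apply: nax; rewrite -ii0 in ai00.
have -> : x = (x - r i) - (0 - r i) by ring.
exact: OmodB.
Qed.

Lemma quotient_pigeonhole a (f : nat -> K) : integral_ideal a -> (forall n, 'O_K (f n)) ->
  exists i j, (i < j)%N /\ a (f j - f i).
Proof.
move=> ai fO; have am := ideal_Omod ai; have [r [_ _ rsurj]] := norm_transversal ai.
have [g gP] := choice (fun n => rsurj _ (fO n)).
have : ~ injective (fun i : 'I_(ideal_norm a).+1 => g i).
  by move/leq_card; rewrite !card_ord ltnn.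
move=> ninj; have [i [j [ij gij]]] : exists i j, i <> j /\ g i = g j.
  apply: contrapT => no; apply: ninj => i j gij; apply: val_inj.
  by apply: contrapT => ij; apply: no; exists i, j.
have aij i' j' : g i' = g j' -> a (f j' - f i').
  move=> gg; have -> : f j' - f i' = (f j' - r (g j')) - (f i' - r (g i')) by rewrite gg; ring.
  exact: OmodB.
have [lt|lt|//] := ltngtP i j; first by exists i, j; split=> //; exact: aij.
by exists j, i; split=> //; exact: aij.
Qed.

(* The powers of x have a common denominator, so two of them differ by an
   integer, and x is a root of a monic 'X^j - 'X^i - o with o integral. *)
Lemma stable_integral a x : integral_ideal a -> (forall y, a y -> a (x * y)) -> 'O_K x.
Proof.
move=> ai ax; case: (ai) => _ _ _ _ [c ac c0].
have acn n : a (x ^+ n * c).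
  by elim: n => [|n IH]; rewrite ?mul1r // exprS -mulrA; exact: ax.
have ci : integral_ideal (principal_ideal c) by apply: principal_ideal_ideal (ideal_O ai ac) c0.
have [i [j [ij [d dO dE]]]] := quotient_pigeonhole ci (fun n => ideal_O ai (acn n)).
have {}dE : d = x ^+ j - x ^+ i by apply: (mulIf c0); rewrite dE mulrBl.
have lt : (size ('X^i + d%:P)%R < size ('X^j : {poly K}))%N.
  rewrite size_polyXn; apply: leq_ltn_trans (size_polyD _ _) _.
  by rewrite gtn_max size_polyXn ltnS ij ltnS; apply: leq_trans (size_polyC_leq1 _) _; case: j ij {dE}.
apply: (@monic_root_O _ _ ('X^j - ('X^i + d%:P))).
- by rewrite monicE lead_coefDl ?size_polyN // lead_coefXn.
- by rewrite /root !hornerE_comm /= !hornerE dE; apply/eqP; ring.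
- move=> k; rewrite coefB coefD !coefXn coefC; apply: OB; first exact: (intO K (k == j)%N).
  by apply: OD; [exact: (intO K (k == i)%N) | case: ifP => _ //; exact: O0].
Qed.

End Norm.

(** * Prime ideals and inverses of ideals *)

Section Primes.
Variable K : fieldExtType rat.
Implicit Types (a b p q : set K) (x y z : K).

Lemma prime_integral p : prime_ideal p -> integral_ideal p.
Proof. by case. Qed.

Lemma prime_n1 p : prime_ideal p -> ~ p 1.
Proof. by case=> pi pO _ p1; apply: pO; exact: ideal_eqO. Qed.

Lemma primeX p x n : prime_ideal p -> 'O_K x -> ~ p x -> ~ p (x ^+ n).
Proof.
move=> pp xO px; elim: n => [|n IH]; first exact: prime_n1.
by rewrite exprS; case: (pp) => _ _ /(_ x (x ^+ n) xO (OX n xO)) h /h[].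
Qed.

(** Two powers of x agree modulo p, by finiteness; cancelling the smaller one, which is not in p,
    exhibits a power of x as an inverse. *)
Lemma prime_maximal p x : prime_ideal p -> 'O_K x -> ~ p x ->
  exists2 y, 'O_K y & p (x * y - 1).
Proof.
move=> pp xO px; have pi := prime_integral pp.
have [i [j [ij pij]]] := quotient_pigeonhole pi (fun n => OX n xO).
exists (x ^+ (j - i).-1); first exact: OX.
rewrite -exprS prednK ?subn_gt0 //.
have [//|] : p (x ^+ i) \/ p (x ^+ (j - i) - 1); last by [].
  case: pp => _ _; apply; [exact: OX | by apply: OB; [exact: OX | exact: O1]|].
  by rewrite mulrBr mulr1 -exprD subnKC // ltnW.
by move=> pxi; case: (primeX pp xO px pxi).
Qed.

Definition idealD a b : set K := [set z | exists x y, [/\ a x, b y & z = x + y]].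

Lemma idealD_Omod a b : Omodule a -> Omodule b -> Omodule (idealD a b).
Proof.
move=> am bm; split.
- by exists 0, 0; split; [exact: Omod0 | exact: Omod0 | rewrite addr0].
- move=> _ _ [x [y [ax bY ->]]] [x' [y' [ax' bY' ->]]].
  by exists (x + x'), (y + y'); split; [exact: OmodD | exact: OmodD | ring].
- move=> d _ dO [x [y [ax bY ->]]]; exists (d * x), (d * y).
  by split; [exact: OmodM | exact: OmodM | ring].
Qed.

Lemma idealD_subl a b : Omodule b -> a `<=` idealD a b.
Proof. by move=> bm x ax; exists x, 0; split=> //; [exact: Omod0 | rewrite addr0]. Qed.

Lemma idealD_subr a b : Omodule a -> b `<=` idealD a b.
Proof. by move=> am x bx; exists 0, x; split=> //; [exact: Omod0 | rewrite add0r]. Qed.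

Lemma idealD_sub a b (c : set K) : Omodule c -> a `<=` c -> b `<=` c -> idealD a b `<=` c.
Proof. by move=> cm ac bc _ [x [y [ax bY ->]]]; apply: OmodD => //; [exact: ac | exact: bc]. Qed.

Lemma idealD_ideal a b : integral_ideal a -> Omodule b -> b `<=` 'O_K ->
  integral_ideal (idealD a b).
Proof.
move=> ai bm bO; have am := ideal_Omod ai; apply: idealI; first exact: idealD_Omod.
  by apply: idealD_sub => //; [exact: Omod_O | move=> x; exact: ideal_O].
by case: ai => _ _ _ _ [x ax x0]; exists x => //; exact: idealD_subl.
Qed.

Lemma principal_subO x : 'O_K x -> principal_ideal x `<=` 'O_K.
Proof. by move=> xO _ [c cO <-]; exact: OM. Qed.

Lemma not_prime a : integral_ideal a -> a <> 'O_K -> ~ prime_ideal a ->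
  exists x y, [/\ 'O_K x, 'O_K y, a (x * y), ~ a x & ~ a y].
Proof.
move=> ai aO np; apply: contrapT => no; apply: np; split=> // x y xO yO axy.
have [ax|nax] := pselect (a x); first by left.
by right; apply: contrapT => nay; apply: no; exists x, y.
Qed.

Lemma adjoin_norm a x : integral_ideal a -> 'O_K x -> ~ a x ->
  integral_ideal (idealD a (principal_ideal x)) /\
  (ideal_norm (idealD a (principal_ideal x)) < ideal_norm a)%N.
Proof.
move=> ai xO nax.
have di : integral_ideal (idealD a (principal_ideal x)).
  by apply: idealD_ideal => //; [exact: principal_Omod | exact: principal_subO].
split=> //; apply: ideal_norm_lt => //; first exact/idealD_subl/principal_Omod.
by move=> aE; apply: nax; rewrite aE; apply: idealD_subr; [exact: ideal_Omod | exact: principal_mem].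
Qed.

Lemma prime_above a : integral_ideal a -> a <> 'O_K ->
  exists2 p, prime_ideal p & a `<=` p.
Proof.
move: {2}(ideal_norm a).+1 (ltnSn (ideal_norm a)) => n; elim: n a => // n IH a lt ai aO.
have [ap|/(not_prime ai aO)[x [y [xO yO axy nax nay]]]] := pselect (prime_ideal a).
  by exists a.
have [di dn] := adjoin_norm ai xO nax.
have [||p pp sub] := IH _ _ di.
- exact: leq_trans dn lt.
(* The enlarged ideal a + (x) stays proper: 1 = u + v x would give y = y u + v x y, an element of
   [a]. *)
- move=> dO; apply: nay; have : idealD a (principal_ideal x) 1 by rewrite dO; exact: O1.
  move=> [u [_ [au [v vO <-] uv]]].
  have -> : y = y * u + v * (x * y) by rewrite -[LHS]mulr1 uv; ring.
  by have am := ideal_Omod ai; apply: OmodD => //; apply: OmodM.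
by exists p => // z az; apply: sub; apply: idealD_subl => //; exact: principal_Omod.
Qed.

Definition idealprod (s : seq (set K)) : set K := foldr (@idealM K) 'O_K s.

Lemma idealprod_ideal s : (forall p, p \in s -> prime_ideal p) -> integral_ideal (idealprod s).
Proof.
elim: s => [_|p s IH ps] /=; first exact: integral_idealO.
apply: idealM_ideal; first by apply/prime_integral/ps; rewrite inE eqxx.
by apply: IH => q qs; apply: ps; rewrite inE qs orbT.
Qed.

Lemma idealprod_cat s t : (forall p, p \in t -> prime_ideal p) ->
  idealprod (s ++ t) = idealM (idealprod s) (idealprod t).
Proof.
move=> tp; elim: s => [|p s IH] /=.
  by rewrite ideal1M //; exact/ideal_Omod/idealprod_ideal.
by rewrite -/(idealprod _) IH idealMA.
Qed.

Lemma idealprod_rem p s : p \in s -> idealprod s = idealM p (idealprod (rem p s)).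
Proof.
elim: s => // q s IH; rewrite inE /= => /orP[/eqP->|ps]; first by rewrite eqxx.
case: eqP => [->//|_] /=; rewrite -!/(idealprod _) IH //; exact: idealMCA.
Qed.

(** Noetherian induction: if x y is in [a], then (a + (x)) (a + (y)) is contained in [a], and both
    factors have smaller norm when x and y are outside [a]. *)
Lemma contains_prime_prod a : integral_ideal a -> exists2 s,
  (forall p, p \in s -> prime_ideal p) & idealprod s `<=` a.
Proof.
move: {2}(ideal_norm a).+1 (ltnSn (ideal_norm a)) => n; elim: n a => // n IH a lt ai.
have am := ideal_Omod ai.
have [->|aO] := pselect (a = 'O_K); first by exists [::].
have [ap|/(not_prime ai aO)[x [y [xO yO axy nax nay]]]] := pselect (prime_ideal a).
  exists [:: a] => [p|]; first by rewrite inE => /eqP->.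
  by rewrite /= idealM1.
have [di dn] := adjoin_norm ai xO nax; have [ei en] := adjoin_norm ai yO nay.
have [s sp ssub] := IH _ (leq_trans dn lt) di.
have [t tp tsub] := IH _ (leq_trans en lt) ei.
exists (s ++ t).
  by move=> p; rewrite mem_cat => /orP[/sp|/tp].
rewrite idealprod_cat //; apply: subset_trans (idealMS ssub tsub) _.
apply: idealM_subO => // _ _ [u [_ [au [v vO <-] ->]]] [w [_ [aw [z zO <-] ->]]].
have uO := ideal_O ai au; have wO := ideal_O ai aw.
have -> : (u + v * x) * (w + z * y) = (w + z * y) * u + (v * x) * w + (v * z) * (x * y) by ring.
by do !apply: OmodD => //; apply: OmodM => //; do ?apply: OD => //; apply: OM.
Qed.

Lemma prime_idealM p a b : prime_ideal p -> a `<=` 'O_K -> b `<=` 'O_K ->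
  idealM a b `<=` p -> a `<=` p \/ b `<=` p.
Proof.
move=> pp aO bO ab; have [|na] := pselect (a `<=` p); first by left.
right=> y bY; have /existsNP[x /not_implyP[ax npx]] := na.
have [//|//] : p x \/ p y; case: (pp) => _ _; apply; [exact: aO | exact: bO|].
by apply: ab; exact: idealM_mem.
Qed.

Lemma prime_sub_eq p q : prime_ideal p -> prime_ideal q -> q `<=` p -> q = p.
Proof.
move=> pp qp sub; have pi := prime_integral pp; apply/seteqP; split=> // x px.
apply: contrapT => nqx; have [y yO /sub pxy] := prime_maximal qp (ideal_O pi px) nqx.
apply: (prime_n1 pp); rewrite -(subKr (x * y) 1); apply: OmodB (ideal_Omod pi) _ pxy.
by rewrite mulrC; apply: OmodM => //; exact: ideal_Omod.
Qed.

Lemma prime_idealprod p s : prime_ideal p -> (forall q, q \in s -> prime_ideal q) ->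
  idealprod s `<=` p -> p \in s.
Proof.
move=> pp; elim: s => [_|q s IH qs] /=.
  by move=> /(_ 1 (O1 K)) /(prime_n1 pp).
have sp r : r \in s -> prime_ideal r by move=> rs; apply: qs; rewrite inE rs orbT.
have qp : prime_ideal q by apply: qs; rewrite inE eqxx.
move=> /(prime_idealM pp)[||sub|sub].
- by move=> x; exact/ideal_O/prime_integral.
- by move=> x; apply: ideal_O; exact: idealprod_ideal.
- by rewrite inE (prime_sub_eq pp qp sub) eqxx.
- by rewrite inE IH ?orbT.
Qed.

Lemma principal1 : principal_ideal (1 : K) = 'O_K.
Proof.
by apply/seteqP; split=> [_ [c cO <-]|c cO]; [rewrite mulr1 | exists c; rewrite ?mulr1].
Qed.

Lemma principalMV x : x != 0 ->
  idealM (principal_ideal x^-1) (principal_ideal x) = 'O_K.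
Proof. by move=> x0; rewrite idealM_principal mulVf // principal1. Qed.

(** For x in p, a shortest product of primes inside (x) has p as a factor, and the product of the
    others yields y outside (x) with y p inside (x). Put d = (x) + (y). Then x^-1 p d lies between p
    and ['O_K], hence is one of them; it is not p, since y / x would then stabilise p and so be
    integral. *)
Lemma prime_inverse p : prime_ideal p -> exists (d : set K) x,
  [/\ integral_ideal d, x != 0, d x & idealM p d = principal_ideal x].
Proof.
move=> pp; have pi := prime_integral pp; have pm := ideal_Omod pi.
case: (pi) => pO _ _ _ [x px x0]; have xO := pO _ px.
have [s0 s0p s0x] := contains_prime_prod (principal_ideal_ideal xO x0).
pose P n := `[< exists s, [/\ size s = n, (forall q, q \in s -> prime_ideal q)
   & idealprod s `<=` principal_ideal x] >].
have exP : exists n, P n by exists (size s0); apply/asboolP; exists s0.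
have [n /asboolP[s [sn sp sx]] nmin] := ex_minnP exP.
have ps : p \in s.
  apply: prime_idealprod => // y /sx[d dO <-]; exact: OmodM.
have remp q : q \in rem p s -> prime_ideal q by move/mem_rem/sp.
have [y ry nxy] : exists2 y, idealprod (rem p s) y & ~ principal_ideal x y.
  apply: contrapT => no.
  have /nmin : P (size (rem p s)).
    apply/asboolP; exists (rem p s); split=> // y ry.
    by apply: contrapT => nxy; apply: no; exists y.
  by rewrite size_rem // -sn; case: (s) ps => //= q s' _; rewrite ltnn.
have yO : 'O_K y by apply: ideal_O ry; exact: idealprod_ideal.
pose d := idealD (principal_ideal x) (principal_ideal y).
have xm := @principal_Omod K x; have ym := @principal_Omod K y.
have di : integral_ideal d.
  by apply: idealD_ideal; [exact: principal_ideal_ideal | exact: principal_Omod | exact: principal_subO].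
have dx : d x by apply: idealD_subl => //; exact: principal_mem.
have dy : d y by apply: idealD_subr => //; exact: principal_mem.
exists d, x; split=> //.
have pdx : idealM p d `<=` principal_ideal x.
  apply: idealM_subO => // u _ pu [_ [_ [[v vO <-] [w wO <-] ->]]].
  have uO := pO _ pu; rewrite mulrDr; apply: OmodD => //.
    by exists (u * v); [exact: OM | ring].
  have -> : u * (w * y) = w * (u * y) by ring.
  apply: OmodM => //; apply: sx; rewrite (idealprod_rem ps); exact: idealM_mem.
apply/seteqP; split=> //; pose e := idealM (principal_ideal x^-1) (idealM p d).
have em : Omodule e by exact/idealM_Omod/principal_Omod.
have pe u : p u -> e u.
  move=> pu; have -> : u = x^-1 * (u * x) by field.
  by apply: idealM_mem; [exact: principal_mem | exact: idealM_mem].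
have eO : e `<=` 'O_K.
  apply: subset_trans (idealMS (@subset_refl _ _) pdx) _.
  by rewrite principalMV.
suff e1 : e 1.
  move=> _ [v vO <-]; apply: OmodM => //; first exact: idealM_Omod.
  suff : idealM (principal_ideal x) e x.
    by rewrite idealMA idealM_principal mulfV // principal1 ideal1M //; exact: idealM_Omod.
  by rewrite -[X in _ X]mulr1; apply: idealM_mem => //; exact: principal_mem.
have [ep|] := pselect (e `<=` p).
  case: nxy; apply/principalP => //; rewrite mulrC; apply: (stable_integral pi) => u pu.
  apply: ep; have -> : x^-1 * y * u = x^-1 * (u * y) by ring.
  by apply: idealM_mem; [exact: principal_mem | exact: idealM_mem].
move=> /existsNP[u /not_implyP[eu npu]].
have [v vO puv] := prime_maximal pp (eO _ eu) npu.
have -> : 1 = v * u - (u * v - 1) :> K by ring.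
by apply: OmodB => //; [exact: OmodM | exact: pe].
Qed.

(** For a prime p containing [a] with p d = (x), the ideal e = x^-1 a d is integral and strictly
    contains [a]: equality would make every element of x^-1 d stabilise [a], so d would lie in (x)
    and 1 in p. The smaller norm of e feeds the induction, and an inverse of e gives one of [a]. *)
Lemma ideal_inverse a : integral_ideal a -> exists (d : set K) x,
  [/\ integral_ideal d, x != 0 & idealM a d = principal_ideal x].
Proof.
move: {2}(ideal_norm a).+1 (ltnSn (ideal_norm a)) => n; elim: n a => // n IH a lt ai.
have am := ideal_Omod ai.
have [->|aO] := pselect (a = 'O_K).
  exists 'O_K, 1; rewrite principal1 idealM1; last exact: Omod_O.
  by split; [exact: integral_idealO | exact: oner_neq0 |].
have [p pp ap] := prime_above ai aO; have pi := prime_integral pp.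
have [d [x [di x0 dx pd]]] := prime_inverse pp.
pose e := idealM (principal_ideal x^-1) (idealM a d).
have em : Omodule e by exact/idealM_Omod/principal_Omod.
have ae : a `<=` e.
  move=> u au; have -> : u = x^-1 * (u * x) by field.
  by apply: idealM_mem; [exact: principal_mem | exact: idealM_mem].
have eO : e `<=` 'O_K.
  rewrite -(principalMV x0) -pd; apply: idealMS => //; exact: idealMS.
have ei : integral_ideal e.
  by apply: idealI => //; case: ai => _ _ _ _ [u au u0]; exists u => //; exact: ae.
have nae : a <> e.
  move=> aE; apply: (prime_n1 pp).
  have dxO y : d y -> principal_ideal x y.
    move=> dy; apply/principalP => //; rewrite mulrC; apply: (stable_integral ai) => u au.
    rewrite [X in X _]aE; have -> : x^-1 * y * u = x^-1 * (u * y) by ring.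
    by apply: idealM_mem; [exact: principal_mem | exact: idealM_mem].
  have : idealM (principal_ideal x^-1) (idealM p (principal_ideal x)) 1.
    suff : idealM (principal_ideal x^-1) (idealM p d) 1 by apply: idealMS => //; exact: idealMS.
    by rewrite pd principalMV //; exact: O1.
  by rewrite idealMCA principalMV // idealM1 //; exact: ideal_Omod.
have [f [y [fi y0 ef]]] := IH e (leq_trans (ideal_norm_lt ai ei ae nae) lt) ei.
exists (idealM d f), (x * y); split; [exact: idealM_ideal | exact: mulf_neq0|].
rewrite -idealM_principal -ef /e -!idealMA (idealMA (principal_ideal x)) idealM_principal mulfV //.
by rewrite principal1 ideal1M //; exact/idealM_Omod.
Qed.

(** The inverse fractional ideal, free of the choices of [d] and [x] made in [ideal_inverse]. *)
Definition idealV a : set K := [set x | forall y, a y -> 'O_K (x * y)].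

Lemma idealV_Omod a : Omodule (idealV a).
Proof.
split=> [y _|x y ax ay z az|d x dO ax z az]; first by rewrite mul0r; exact: O0.
  by rewrite mulrDl; apply: OD; [exact: ax | exact: ay].
by rewrite -mulrA; apply: OM => //; exact: ax.
Qed.

Lemma idealMV a : integral_ideal a -> idealM a (idealV a) = 'O_K.
Proof.
move=> ai; have [d [x [di x0 ad]]] := ideal_inverse ai; apply/seteqP; split.
  by apply: idealM_subO; [exact: Omod_O | move=> u v au av; rewrite mulrC; exact: av].
rewrite -(principalMV x0) -ad idealMCA; apply: idealMS => //.
apply: idealM_subO; first exact: idealV_Omod.
move=> _ v [c cO <-] dv u au.
have -> : c * x^-1 * v * u = c * (x^-1 * (u * v)) by ring.
apply: OM => //; rewrite -(principal1) -(mulVf x0) -idealM_principal -ad.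
by apply: idealM_mem; [exact: principal_mem | exact: idealM_mem].
Qed.

Lemma idealM_subI a b (c : set K) : integral_ideal a -> Omodule b -> Omodule c ->
  idealM a b `<=` idealM a c -> b `<=` c.
Proof.
move=> ai bm cm sub; rewrite -(ideal1M bm) -(ideal1M cm) -(idealMV ai).
by rewrite ![idealM a (idealV a)]idealMC -!idealMA; apply: idealMS.
Qed.

Lemma idealM_inj a b (c : set K) : integral_ideal a -> Omodule b -> Omodule c ->
  idealM a b = idealM a c -> b = c.
Proof.
move=> ai bm cm abc; apply/seteqP; split; apply: (idealM_subI ai) => //; rewrite abc //.
Qed.

Lemma sub_dvd a b : integral_ideal a -> integral_ideal b -> b `<=` a -> ideal_dvd a b.
Proof.
move=> ai bi ba; have bm := ideal_Omod bi.
have bE : b = idealM a (idealM (idealV a) b) by rewrite idealMA idealMV // ideal1M.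
exists (idealM (idealV a) b) => //; apply: idealI; first exact/idealM_Omod/idealV_Omod.
  by rewrite -(idealMV ai) idealMC; apply: idealMS.
case: bi => _ _ _ _ [x bx x0]; case: ai => aO _ _ _ _.
exists x => //; rewrite -[x]mul1r; apply: idealM_mem => // y ay; rewrite mul1r; exact: aO.
Qed.

Lemma dvd_sub a b : integral_ideal a -> ideal_dvd a b -> b `<=` a.
Proof. by move=> ai [d di ->]; exact: idealM_subl. Qed.

End Primes.

(** * Divisors and prime avoidance *)

Section Divisors.
Variable K : fieldExtType rat.
Implicit Types (a b p q : set K) (x y z : K).

Lemma prime_idealM_proper a p : prime_ideal p -> integral_ideal a ->
  exists2 w, a w & ~ idealM p a w.
Proof.
move=> pp ai; have pi := prime_integral pp.
apply: contrapT => no; have pa : a `<=` idealM p a.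
  by move=> w aw; apply: contrapT => npw; apply: no; exists w.
apply: (prime_n1 pp); suff -> : p = 'O_K by exact: O1.
apply: (idealM_inj ai); [exact: ideal_Omod | exact: Omod_O|].
rewrite idealM1 1?idealMC; last exact: ideal_Omod.
by apply/seteqP; split=> //; exact: idealM_subr.
Qed.

(* For w in a outside p a, multiplication by w induces 'O_K / p = a / p a. *)
Lemma transversal_prime a p : prime_ideal p -> integral_ideal a ->
  exists r : 'I_(ideal_norm p) -> K, transversal a (idealM p a) r.
Proof.
move=> pp ai; have pi := prime_integral pp; have am := ideal_Omod ai.
have pam : Omodule (idealM p a) by exact/ideal_Omod/idealM_ideal.
have pasub : idealM p a `<=` a by exact: idealM_subr.
have [w aw npw] := prime_idealM_proper pp ai.
have kerw y : 'O_K y -> idealM p a (w * y) -> p y.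
  move=> yO pwy; apply: contrapT => npy; apply: npw.
  have [z zO pyz] := prime_maximal pp yO npy.
  have -> : w = z * (w * y) - (y * z - 1) * w by ring.
  by apply: OmodB => //; [exact: OmodM | exact: idealM_mem].
pose J := idealD (idealM p a) (principal_ideal w).
have Jm : Omodule J by apply: idealD_Omod => //; exact: principal_Omod.
have Ja : J `<=` a.
  by apply: idealD_sub => // _ [c cO <-]; exact: OmodM.
(* By maximality of p: a^-1 J lies between p and ['O_K], and it is not contained in p because w is
   in J but not in p a. *)
have aJ : a `<=` J.
  have JV : idealM (idealV a) J `<=` 'O_K.
    by rewrite -(idealMV ai) idealMC; apply: idealMS.
  have pJV : p `<=` idealM (idealV a) J.
    rewrite -{1}(idealM1 (ideal_Omod pi)) -(idealMV ai) idealMA idealMC.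
    by apply: idealMS => //; exact/idealD_subl/principal_Omod.
  have JVm : Omodule (idealM (idealV a) J) by exact/idealM_Omod/idealV_Omod.
  have JVi : integral_ideal (idealM (idealV a) J).
    by apply: idealI => //; case: pi => _ _ _ _ [x px x0]; exists x => //; exact: pJV.
  suff JV1 : idealM (idealV a) J 1.
    rewrite -{1}(idealM1 am) -(ideal_eqO JVi JV1) idealMA idealMV //.
    by rewrite ideal1M.
  have [sub|/existsNP[x /not_implyP[Jx npx]]] := pselect (idealM (idealV a) J `<=` p).
    case: npw; have Jw : J w by apply: idealD_subr => //; exact: principal_mem.
    have : idealM a (idealM (idealV a) J) w by rewrite idealMA idealMV // ideal1M.
    by rewrite idealMC => /(idealMS sub (@subset_refl _ a)).
  have [y yO pxy] := prime_maximal pp (JV _ Jx) npx.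
  have -> : 1 = y * x - (x * y - 1) :> K by ring.
  by apply: OmodB => //; [exact: OmodM | exact: pJV].
have [r [rO rinj rsurj]] := norm_transversal pi.
exists (fun i => w * r i); split=> [i|i j|x ax].
- by rewrite mulrC; apply: OmodM.
- by rewrite -mulrBr => /kerw h; apply/rinj/h; exact: OB.
- have [u [_ [pau [c cO <-] xE]]] := aJ _ ax.
  have [i pci] := rsurj _ cO; exists i.
  have -> : x - w * r i = u + (c - r i) * w by rewrite xE; ring.
  by apply: OmodD => //; exact: idealM_mem.
Qed.

(** Representatives of ['O_K / p a] are the sums of those of [a / p a] and of ['O_K / a]. *)
Lemma norm_primeM a p : prime_ideal p -> integral_ideal a ->
  ideal_norm (idealM p a) = (ideal_norm p * ideal_norm a)%N.
Proof.
move=> pp ai; have pi := prime_integral pp; have am := ideal_Omod ai.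
have pam : Omodule (idealM p a) by exact/ideal_Omod/idealM_ideal.
have [r [ra rinj rsurj]] := transversal_prime pp ai.
have [s [sO sinj ssurj]] := norm_transversal ai.
rewrite -(card_ord (ideal_norm p)) -(card_ord (ideal_norm a)) -card_prod.
apply: (norm_card (r := fun ij => r ij.1 + s ij.2)) => //; split.
- by case=> i j /=; apply: OD => //; apply: ideal_O (ra i).
- move=> [i j] [i' j'] /= pE; have jj : j = j'.
    apply: sinj; have -> : s j - s j' = (r i + s j - (r i' + s j')) - r i + r i' by ring.
    by apply: OmodD => //; apply: OmodB => //; exact: (idealM_subr pi ai).
  congr (_, _) => //; apply: rinj; rewrite jj in pE.
  by have -> : r i - r i' = r i + s j' - (r i' + s j') by ring.
- move=> x xO; have [j aj] := ssurj _ xO; have [i ij] := rsurj _ aj.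
  by exists (i, j); rewrite /= opprD addrA addrAC.
Qed.

Lemma norm_O : ideal_norm ('O_K : set K) = 1%N.
Proof.
rewrite -(card_ord 1); apply: (norm_card (r := fun=> 0)); first exact: Omod_O.
split=> [_|i j _|x xO]; first exact: O0.
  by rewrite !ord1.
by exists ord0; rewrite subr0.
Qed.

(** An ideal above [a] is determined by the finite set of residue classes modulo [a] that it
    contains. *)
Lemma finite_overideals a : integral_ideal a ->
  finite_set [set d | integral_ideal d /\ a `<=` d].
Proof.
move=> ai; have [r [rO rinj rsurj]] := norm_transversal ai.
pose D (S : {set 'I_(ideal_norm a)}) := [set x | exists2 i, i \in S & a (x - r i)].
apply: (@sub_finite_set _ _ (D @` [set: _])); last exact/finite_image/finite_finset.
move=> d [di ad]; have dm := ideal_Omod di.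
exists [set i | `[< d (r i) >] ]%SET => //; apply/seteqP; split=> x.
  move=> [i]; rewrite inE => /asboolP dri axi.
  by rewrite -(subrK (r i) x); apply: OmodD => //; exact: ad.
move=> dx; have [i axi] := rsurj _ (ideal_O di dx); exists i => //.
rewrite inE; apply/asboolP; have -> : r i = x - (x - r i) by ring.
by apply: OmodB => //; exact: ad.
Qed.

Lemma primes_over a : integral_ideal a ->
  exists s : seq (set K), forall p, p \in s <-> prime_ideal p /\ a `<=` p.
Proof.
move=> ai; have /finite_seqP[s sE] : finite_set [set p | prime_ideal p /\ a `<=` p].
  apply: sub_finite_set (finite_overideals ai) => p [pp ap].
  by split=> //; exact: prime_integral.
by exists s => p; have -> : is_true (p \in s) = [set` s] p by []; rewrite -sE.
Qed.

(** Generalizes [Omodule] to vectors: prime avoidance is applied both to ideals, through [K^o], and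
    to lattices. *)
Definition submodule (V : lmodType K) (M : set V) :=
  [/\ M 0, (forall u v, M u -> M v -> M (u + v))
    & (forall c u, 'O_K c -> M u -> M (c *: u))].

(** A prime different from p has an element outside p; [t] is a product of such elements. *)
Lemma separate_prime p (s : seq (set K)) : prime_ideal p ->
  (forall q, q \in s -> prime_ideal q) -> p \notin s ->
  exists t, [/\ 'O_K t, ~ p t & forall q, q \in s -> q t].
Proof.
move=> pp; elim: s => [_ _|q s IH qs].
  by exists 1; split=> //; [exact: O1 | exact: prime_n1].
rewrite inE negb_or => /andP[/eqP pq ps].
have qp : prime_ideal q by apply: qs; rewrite inE eqxx.
have [t [tO npt ts]] := IH (fun r rs => qs r (mem_behead (s := q :: s) rs)) ps.
have [x qx npx] : exists2 x, q x & ~ p x.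
  apply: contrapT => no; apply: pq; apply/esym/prime_sub_eq => // x qx.
  by apply: contrapT => npx; apply: no; exists x.
have xO := ideal_O (prime_integral qp) qx.
exists (x * t); split; first exact: OM.
  by case: (pp) => _ _ /(_ x t xO tO) h /h[].
move=> r; rewrite inE => /orP[/eqP->|rs].
  by rewrite mulrC; apply: OmodM => //; exact/ideal_Omod/prime_integral.
apply: OmodM => //; last exact: ts.
by apply/ideal_Omod/prime_integral/qs; rewrite inE rs orbT.
Qed.

(** Each [N p] contains p M, so it imposes a condition on M / p M only. A vector u that is good at
    the other primes but bad at p is corrected by t w, with w good at p and t in the other primes
    but not in p: the classes at the other primes do not change. *)
Lemma prime_avoidance (V : lmodType K) (M : set V) (N : set K -> set V) (s : seq (set K)) :
  submodule M -> (forall p, p \in s -> prime_ideal p) ->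
  (forall p, p \in s -> submodule (N p)) ->
  (forall p c u, p \in s -> p c -> M u -> N p (c *: u)) ->
  (forall p, p \in s -> exists2 u, M u & ~ N p u) ->
  exists2 u, M u & forall p, p \in s -> ~ N p u.
Proof.
move=> [M0 MD MZ]; elim: s => [|p s IH] sp sN pN sex.
  by exists 0.
have in1 q : q \in s -> q \in p :: s by rewrite inE orbC => ->.
have [u Mu uN] := IH (fun q qs => sp q (in1 q qs)) (fun q qs => sN q (in1 q qs))
  (fun q c u qs => pN q c u (in1 q qs)) (fun q qs => sex q (in1 q qs)).
have [ps|ps] := boolP (p \in s).
  by exists u => // q; rewrite inE => /orP[/eqP->|]; exact: uN.
have pin : p \in p :: s by rewrite inE eqxx.
have [Npu|Npu] := pselect (N p u); last first.
  by exists u => // q; rewrite inE => /orP[/eqP->|/uN].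
have pp := sp _ pin; have [w Mw nw] := sex _ pin.
have [t [tO npt ts]] := separate_prime pp (fun q qs => sp q (in1 q qs)) ps.
exists (u + t *: w); first exact/MD/MZ.
move=> q; rewrite inE => /orP[/eqP->|qs] Nq.
  (* With y inverse to t modulo p, having both u and u + t w in [N p] would force w into [N p]. *)
  apply: nw; have [y yO pty] := prime_maximal pp tO npt; have [_ ND NZ] := sN _ pin.
  have -> : w = y *: (u + t *: w) + ((- y) *: u + (- 1) *: ((t * y - 1) *: w)).
    rewrite scalerDr !scalerA addrACA -!scalerDl subrr scale0r add0r.
    by rewrite -[LHS]scale1r; congr (_ *: _); ring.
  apply: (ND); first exact: NZ.
  apply: (ND); first by apply: NZ => //; exact: ON.
  by apply: NZ; [exact/ON/O1 | exact: pN].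
apply: (uN q qs); have [_ ND NZ] := sN _ (in1 q qs).
have -> : u = (u + t *: w) + (- 1) *: (t *: w) by rewrite scaleN1r addrK.
apply: ND => //; apply: NZ; first exact/ON/O1.
by apply: pN; [exact: in1 | exact: ts |].
Qed.

(** * Exponents of primes and sets of prime divisors *)

Lemma prime_power_split p b : prime_ideal p -> integral_ideal b ->
  exists e (c : set K), [/\ integral_ideal c, ~ c `<=` p & b = idealM (idealX p e) c].
Proof.
move=> pp; have pi := prime_integral pp.
move: {2}(ideal_norm b).+1 (ltnSn (ideal_norm b)) => n; elim: n b => // n IH b lt bi.
have [bp|nbp] := pselect (b `<=` p); last first.
  by exists 0%N, b; split=> //; rewrite ideal1M //; exact: ideal_Omod.
have [c ci bE] := sub_dvd pi bi bp.
have [|e [d [di ndp cE]]] := IH c _ ci.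
  suff cb : (ideal_norm c < ideal_norm b)%N by exact: leq_trans cb lt.
  apply: ideal_norm_lt => //; first by rewrite bE; exact: idealM_subr.
  move=> bc; apply: (prime_n1 pp); suff -> : p = 'O_K by exact: O1.
  apply: (idealM_inj ci); [exact: ideal_Omod | exact: Omod_O|].
  by rewrite (idealM1 (ideal_Omod ci)) idealMC -bE.
by exists e.+1, d; split=> //; rewrite bE cE idealMA idealXS.
Qed.

Lemma idealX_sub p k : integral_ideal p -> (0 < k)%N -> idealX p k `<=` p.
Proof. by case: k => // k pi _; rewrite idealXS; apply: idealM_subl => //; exact: idealX_ideal. Qed.

Lemma idealXD p m n : integral_ideal p -> idealX p (m + n) = idealM (idealX p m) (idealX p n).
Proof.
move=> pi; elim: m => [|m IH].
  by rewrite ideal1M //; exact/ideal_Omod/idealX_ideal.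
by rewrite addSn !idealXS IH idealMA.
Qed.

Lemma exponent_dvd p e k (c : set K) : prime_ideal p -> integral_ideal c -> ~ c `<=` p ->
  ideal_dvd (idealX p k) (idealM (idealX p e) c) <-> (k <= e)%N.
Proof.
move=> pp ci ncp; have pi := prime_integral pp.
have Xi n := idealX_ideal n pi.
split=> [[d di dE]|ke].
  rewrite leqNgt; apply/negP => ek; apply: ncp.
  move: dE; rewrite -(subnKC ek) addSnnS idealXD // -idealMA.
  move=> /(idealM_inj (Xi e)) ->; try by apply: ideal_Omod; do ?exact: idealM_ideal.
  by apply: subset_trans (idealM_subl _ _) (idealX_sub _ _).
exists (idealM (idealX p (e - k)) c); first exact: idealM_ideal.
by rewrite idealMA -idealXD // subnKC.
Qed.

Lemma exponent_eq p e (c : set K) : prime_ideal p -> integral_ideal c -> ~ c `<=` p ->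
  ideal_exponent p (idealM (idealX p e) c) = e.
Proof.
move=> pp ci ncp; apply: xget_unique => /=.
  split; first by apply: (@exponent_dvd p e e c pp ci ncp).2.
  by move=> h; have := (@exponent_dvd p e e.+1 c pp ci ncp).1 h; rewrite ltnn.
move=> k [h nk]; have ke := (@exponent_dvd p e k c pp ci ncp).1 h.
have ek : (e <= k)%N.
  by rewrite leqNgt; apply/negP => lt; apply: nk; exact: (@exponent_dvd p e k.+1 c pp ci ncp).2.
by apply/eqP; rewrite eqn_leq ke.
Qed.

Lemma exponent_unique p e k (c d : set K) : prime_ideal p -> integral_ideal c -> integral_ideal d ->
  ~ c `<=` p -> ~ d `<=` p -> idealM (idealX p e) c = idealM (idealX p k) d -> e = k /\ c = d.
Proof.
move=> pp ci di ncp ndp E; have ek : e = k.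
  by rewrite -(exponent_eq e pp ci ncp) E exponent_eq.
split=> //; rewrite -ek in E; apply: (idealM_inj _ _ _ E); try exact: ideal_Omod.
exact/idealX_ideal/prime_integral.
Qed.

Lemma not_sub_idealM p a b : prime_ideal p -> integral_ideal a -> integral_ideal b ->
  ~ a `<=` p -> ~ b `<=` p -> ~ idealM a b `<=` p.
Proof.
move=> pp ai bi na nb /(prime_idealM pp)[] // x; exact: ideal_O.
Qed.

Lemma not_sub_idealX p q e : prime_ideal p -> prime_ideal q -> p <> q -> ~ idealX p e `<=` q.
Proof.
move=> pp qp pq; have pi := prime_integral pp; elim: e => [|e IH] /=.
  by move=> /(_ _ (O1 K)) /(prime_n1 qp).
apply: not_sub_idealM => //; first exact: idealX_ideal.
by move=> /(prime_sub_eq qp pp).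
Qed.

Lemma exponent_coprime p q e (c : set K) : prime_ideal p -> prime_ideal q -> p <> q ->
  integral_ideal c -> ideal_exponent q (idealM (idealX p e) c) = ideal_exponent q c.
Proof.
move=> pp qp pq ci; have [k [d [di ndq ->]]] := prime_power_split qp ci.
have Xi := idealX_ideal e (prime_integral pp).
rewrite idealMCA !exponent_eq //; first exact: idealM_ideal.
by apply: not_sub_idealM => //; exact: not_sub_idealX.
Qed.

Lemma prime_divisorsE b p : integral_ideal b ->
  prime_divisors b p <-> prime_ideal p /\ b `<=` p.
Proof.
move=> bi; split=> -[pp h]; split=> //; have pi := prime_integral pp.
  exact: dvd_sub.
exact: sub_dvd.
Qed.

Lemma finite_prime_divisors b : integral_ideal b -> finite_set (prime_divisors b).
Proof.
move=> bi; apply: sub_finite_set (finite_overideals bi) => p /(prime_divisorsE _ bi)[pp bp].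
by split=> //; exact: prime_integral.
Qed.

Lemma prime_divisors_primeM p (c : set K) : prime_ideal p -> integral_ideal c ->
  prime_divisors (idealM p c) = p |` prime_divisors c.
Proof.
move=> pp ci; have pi := prime_integral pp; have pci := idealM_ideal pi ci.
apply/seteqP; split=> q; rewrite /setU /= !prime_divisorsE //.
  move=> [qp /(prime_idealM qp)[|||cq]]; try by move=> x; exact: ideal_O.
  - by move/(prime_sub_eq qp pp) => ->; left.
  - by right.
move=> [->|[qp cq]]; split=> //; first exact: idealM_subl.
by apply: subset_trans cq; exact: idealM_subr.
Qed.

Lemma prime_divisors_split p e (c : set K) : prime_ideal p -> integral_ideal c -> 
  prime_divisors (idealM (idealX p e.+1) c) = p |` prime_divisors c.
Proof.
move=> pp ci; have pi := prime_integral pp; elim: e => [|e IH].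
  by rewrite idealXS /= idealM1 ?prime_divisors_primeM //; exact: ideal_Omod.
rewrite idealXS -idealMA prime_divisors_primeM ?IH; last 2 first.
- exact: pp.
- by apply: idealM_ideal => //; exact: idealX_ideal.
by rewrite setUA setUid.
Qed.

Lemma prime_divisors_O : prime_divisors ('O_K : set K) = set0.
Proof.
rewrite -subset0 => p; rewrite prime_divisorsE; last exact: integral_idealO.
by move=> [pp /(_ _ (O1 K)) /(prime_n1 pp)].
Qed.

End Divisors.

(** * The sum of psi over the factorizations *)

Section Counting.
Variable K : fieldExtType rat.
Implicit Types (a b p q : set K) (x y z : K).

Lemma psi_O : psi ('O_K : set K) = 1.
Proof. by rewrite /psi norm_O prime_divisors_O fsbig_set0 mulr1. Qed.

Lemma eta_O : eta ('O_K : set K) = 1%N.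
Proof. by rewrite /eta prime_divisors_O fsbig_set0. Qed.

Lemma prime_norm_neq0 p : prime_ideal p -> (ideal_norm p)%:R != 0 :> rat.
Proof.
by move=> pp; rewrite pnatr_eq0 -lt0n; apply/ideal_norm_gt0/prime_integral.
Qed.

(** When p already divides c, only the norm factor of psi changes; in [psi_primeM_ndvd] the new
    factor 1 + N(p)^-1 turns N(p) into N(p) + 1. *)
Lemma psi_primeM_dvd p (c : set K) : prime_ideal p -> integral_ideal c -> c `<=` p ->
  psi (idealM p c) = (ideal_norm p)%:R * psi c.
Proof.
move=> pp ci cp; rewrite /psi norm_primeM // natrM -mulrA prime_divisors_primeM //.
by rewrite setUidr // => _ ->; apply/prime_divisorsE.
Qed.

Lemma psi_primeM_ndvd p (c : set K) : prime_ideal p -> integral_ideal c -> ~ c `<=` p ->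
  psi (idealM p c) = (ideal_norm p + 1)%:R * psi c.
Proof.
move=> pp ci ncp; rewrite /psi norm_primeM // prime_divisors_primeM //.
rewrite fsbigU0 ?fsbig_set1; last 3 first.
- exact: finite_set1.
- exact: finite_prime_divisors.
- by move=> _ [-> /(prime_divisorsE _ ci)[]].
by rewrite /= natrM natrD; field; exact: prime_norm_neq0.
Qed.

Lemma psi_primeXM p (c : set K) e : prime_ideal p -> integral_ideal c -> ~ c `<=` p ->
  psi (idealM (idealX p e.+1) c) =
  ((ideal_norm p)%:R ^+ e.+1 + (ideal_norm p)%:R ^+ e) * psi c.
Proof.
move=> pp ci ncp; have pi := prime_integral pp; elim: e => [|e IH].
  by rewrite idealXS /= idealM1 ?psi_primeM_ndvd ?natrD //; exact: ideal_Omod.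
have Xi := idealX_ideal e.+1 pi.
rewrite idealXS -idealMA psi_primeM_dvd ?IH; [by rewrite !exprS; ring|by []| |].
  exact: idealM_ideal.
by apply: subset_trans (idealM_subl Xi ci) (idealX_sub _ _).
Qed.

Lemma eta_primeXM p (c : set K) e : prime_ideal p -> integral_ideal c -> ~ c `<=` p ->
  eta (idealM (idealX p e.+1) c) = ((\sum_(k < e.+2) ideal_norm p ^ k) * eta c)%N.
Proof.
move=> pp ci ncp; rewrite /eta prime_divisors_split //.
rewrite fsbigU0 ?fsbig_set1; last 3 first.
- exact: finite_set1.
- exact: finite_prime_divisors.
- by move=> _ [-> /(prime_divisorsE _ ci)[]].
rewrite exponent_eq //; congr (_ * _)%N; apply: eq_fsbigr => q /set_mem.
move=> /(prime_divisorsE _ ci)[qp cq]; rewrite exponent_coprime // => pq.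
by apply: ncp; rewrite pq.
Qed.

Lemma sq_factorizationE b f : sq_factorizations b f <->
  [/\ integral_ideal f.1, integral_ideal f.2 & b = idealM f.1 (idealM f.2 f.2)].
Proof.
split=> -[f1 f2 ->]; split=> //; rewrite idealX2 //; exact: ideal_Omod.
Qed.

Lemma finite_sq_factorizations b : integral_ideal b -> finite_set (sq_factorizations b).
Proof.
move=> bi; pose D := [set d | integral_ideal d /\ b `<=` d].
apply: (@sub_finite_set _ _ (D `*` D)); last first.
  by apply: finite_setX; exact: finite_overideals.
move=> [c d] /sq_factorizationE[/= ci di bE]; have dd := idealM_ideal di di.
split; split=> //=; rewrite bE; first exact: idealM_subl.
by apply: subset_trans (idealM_subr ci dd) (idealM_subl di di).
Qed.

Definition psisum b : rat := \sum_(f \in sq_factorizations b) psi f.1.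

Lemma psisum_O : psisum ('O_K : set K) = 1.
Proof.
have Oi := integral_idealO K; have Om := @Omod_O K.
rewrite /psisum; have -> : sq_factorizations ('O_K : set K) = [set ('O_K, 'O_K)].
  apply/seteqP; split=> [[c d] /sq_factorizationE[/= ci di OE]|_ ->].
    have dd := idealM_ideal di di; congr (_, _); apply: ideal_eqO => //.
      by apply: (idealM_subl ci dd); rewrite -OE; exact: O1.
    by apply: (idealM_subl di di); apply: (idealM_subr ci dd); rewrite -OE; exact: O1.
  by apply/sq_factorizationE; split=> //=; rewrite !idealM1.
by rewrite fsbig_set1 psi_O.
Qed.

(** This is psi(p^e); at e = 0 the factor 1 + N(p)^-1 is absent. *)
Definition psip p e : rat :=
  if e is e'.+1 then (ideal_norm p)%:R ^+ e + (ideal_norm p)%:R ^+ e' else 1.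

Section Split.
Variables (p c : set K).
Hypotheses (pp : prime_ideal p) (ci : integral_ideal c) (ncp : ~ c `<=` p).

Let pi : integral_ideal p. Proof. exact: prime_integral. Qed.

(** These are the factorizations of p^e c whose second member is prime to p: all of p^e then lies in
    the first. *)
Definition sq_factorizations_away e :=
  [set (idealM (idealX p e) f.1, f.2) | f in sq_factorizations c].

Lemma sq_factorizations_away_sub e :
  sq_factorizations_away e `<=` sq_factorizations (idealM (idealX p e) c).
Proof.
move=> _ [[d1 d2] /sq_factorizationE[/= d1i d2i cE] <-].
apply/sq_factorizationE; split=> //=; last by rewrite cE idealMA.
by apply: idealM_ideal => //; exact: idealX_ideal.
Qed.

Lemma sq_factorizations_ndvd e f : sq_factorizations (idealM (idealX p e) c) f ->
  ~ f.2 `<=` p -> sq_factorizations_away e f.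
Proof.
case: f => b1 b2 /sq_factorizationE[/= b1i b2i bE] nb2.
have [k [d [di ndp b1E]]] := prime_power_split pp b1i.
have bb := idealM_ideal b2i b2i.
have nbb := not_sub_idealM pp b2i b2i nb2 nb2.
move: bE; rewrite b1E -idealMA.
move=> /(exponent_unique pp ci (idealM_ideal di bb) ncp (not_sub_idealM pp di bb ndp nbb)).
by move=> [-> cE]; exists (d, b2) => //; apply/sq_factorizationE.
Qed.

Lemma sq_factorizations_away_ndvd e f : sq_factorizations_away e f -> ~ f.2 `<=` p.
Proof.
move=> [[d1 d2] /sq_factorizationE[/= d1i d2i cE] <-] /= d2p; apply: ncp; rewrite cE.
have dd := idealM_ideal d2i d2i.
by apply: subset_trans (idealM_subr d1i dd) _; apply: subset_trans (idealM_subl d2i d2i) _.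
Qed.

Lemma psisum_away e :
  \sum_(f \in sq_factorizations_away e) psi f.1 = psip p e * psisum c.
Proof.
have Xi := idealX_ideal e pi.
rewrite fsbig_image => [|[d1 d2] [d1' d2'] /set_mem h /set_mem h' /= [E ->]]; last first.
  congr (_, _); apply: (idealM_inj Xi) => //; apply: ideal_Omod.
    by case/sq_factorizationE: h.
  by case/sq_factorizationE: h'.
rewrite /psisum mulr_fsumr; apply: eq_fsbigr => -[d1 d2] /set_mem /sq_factorizationE[/= d1i d2i cE].
have nd1 : ~ d1 `<=` p.
  move=> d1p; apply: ncp; rewrite cE; apply: subset_trans d1p; apply: idealM_subl => //.
  exact: idealM_ideal.
case: e Xi => [|e] Xi; last by rewrite psi_primeXM.
by rewrite /= ideal1M ?mul1r //; exact: ideal_Omod.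
Qed.

(** A second member divisible by p would make p^2 divide p^e c. *)
Lemma psisum_small e : (e < 2)%N ->
  psisum (idealM (idealX p e) c) = psip p e * psisum c.
Proof.
move=> e2; rewrite -psisum_away /psisum; apply: eq_fsbigl.
apply/seteqP; split; last exact: sq_factorizations_away_sub.
move=> f ff; apply: sq_factorizations_ndvd => // f2p.
case: f ff f2p => b1 b2 /sq_factorizationE[/= b1i b2i bE] b2p.
have [d di dE] := sub_dvd pi b2i b2p.
have dd := idealM_ideal di di.
have : ideal_dvd (idealX p 2) (idealM (idealX p e) c).
  exists (idealM b1 (idealM d d)); first exact: idealM_ideal.
  by rewrite bE dE (idealMACA p) idealMCA idealX2 //; exact: ideal_Omod.
by move/(@exponent_dvd _ p e 2 c pp ci ncp).1; rewrite leqNgt e2.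
Qed.

(** Either b2 is prime to p, or p can be cancelled from it; the latter case gives the factorizations
    (b1, b2 / p) of p^e c, with b1 and hence psi(b1) unchanged. *)
Lemma psisum_step e : psisum (idealM (idealX p e.+2) c) =
  psip p e.+2 * psisum c + psisum (idealM (idealX p e) c).
Proof.
set b := idealM (idealX p e) c.
have bi : integral_ideal b by apply: idealM_ideal => //; exact: idealX_ideal.
have bE : idealM (idealX p e.+2) c = idealM (idealM p p) b.
  by rewrite /b !idealXS !idealMA.
pose B := [set (f.1, idealM p f.2) | f in sq_factorizations b].
have sqE : sq_factorizations (idealM (idealX p e.+2) c) = sq_factorizations_away e.+2 `|` B.
  apply/seteqP; split=> [f ff|f [|[[b1 b2] /sq_factorizationE[/= b1i b2i b'E] <-]]].
  - have [f2p|] := pselect (f.2 `<=` p); last by left; exact: sq_factorizations_ndvd.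
    right; case: f ff f2p => b1 b2 /sq_factorizationE[/= b1i b2i b'E] b2p.
    have [d di dE] := sub_dvd pi b2i b2p; have dd := idealM_ideal di di.
    exists (b1, d); last by rewrite dE.
    apply/sq_factorizationE; split=> //=.
    have ppi := idealM_ideal pi pi.
    apply: (idealM_inj ppi); try by apply: ideal_Omod; do ?exact: idealM_ideal.
    by rewrite -bE b'E dE (idealMACA p) idealMCA.
  - exact: sq_factorizations_away_sub.
  - apply/sq_factorizationE; split; [exact: b1i | exact: idealM_ideal |].
    by rewrite bE b'E idealMCA idealMACA.
rewrite -psisum_away /psisum sqE fsbigU0; last 3 first.
- exact/finite_image/finite_sq_factorizations.
- exact/finite_image/finite_sq_factorizations.
- move=> f [/sq_factorizations_away_ndvd nf [[b1 b2] /sq_factorizationE[/= b1i b2i _] fE]].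
  by apply: nf; rewrite -fE; exact: idealM_subl.
congr (_ + _); rewrite fsbig_image // => -[d1 d2] [d1' d2'] /set_mem h /set_mem h' /= [-> E].
congr (_, _); apply: (idealM_inj pi) => //; apply: ideal_Omod.
  by case/sq_factorizationE: h.
by case/sq_factorizationE: h'.
Qed.

Lemma psisum_primeX e : psisum (idealM (idealX p e) c) =
  (\sum_(k < e.+1) (ideal_norm p)%:R ^+ k) * psisum c.
Proof.
(* The recursion skips one exponent, so two consecutive values are carried; psi(p^(n+2)) supplies
   exactly the two top terms of the geometric sum. *)
suff H : forall n, 
    psisum (idealM (idealX p n) c) = (\sum_(k < n.+1) (ideal_norm p)%:R ^+ k) * psisum c /\
    psisum (idealM (idealX p n.+1) c) = (\sum_(k < n.+2) (ideal_norm p)%:R ^+ k) * psisum c.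
  by have [] := H e.
elim=> [|n [IH1 IH2]]; last first.
  split=> //; rewrite psisum_step IH1 [in RHS]big_ord_recr [in RHS]big_ord_recr /=.
  by ring.
by split; rewrite psisum_small // !big_ord_recr big_ord0 /=; ring.
Qed.

End Split.

Lemma psisum_eta b : integral_ideal b -> psisum b = (eta b)%:R.
Proof.
move: {2}(ideal_norm b).+1 (ltnSn (ideal_norm b)) => n; elim: n b => // n IH b lt bi.
have [->|bO] := pselect (b = 'O_K); first by rewrite psisum_O eta_O.
have [p pp bp] := prime_above bi bO.
have [[|e] [c [ci ncp bE]]] := prime_power_split pp bi.
  by case: ncp; move: bE; rewrite ideal1M => [<-//|]; exact: ideal_Omod.
have Xi := idealX_ideal e.+1 (prime_integral pp).
have cb : (ideal_norm c < ideal_norm b)%N.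
  apply: ideal_norm_lt => //; first by rewrite bE; exact: idealM_subr.
  by move=> bc; apply: ncp; rewrite -bc.
rewrite bE psisum_primeX // eta_primeXM // (IH c (leq_trans cb lt) ci) natrM natr_sum.
by congr (_ * _); apply: eq_bigr => k _; rewrite natrX.
Qed.

End Counting.

(** * Coset representatives of Gamma_0 *)

Section Matrices2.
Variable R : comNzRingType.
Implicit Types (M N : 'M[R]_2).

Definition mx2 (a b c d : R) : 'M[R]_2 :=
  \matrix_(i, j) if i == 0 then if j == 0 then a else b else if j == 0 then c else d.

Definition rv2 (x y : R) : 'rV[R]_2 := \row_j if j == 0 then x else y.

Lemma ord2P (i : 'I_2) : i = 0 \/ i = 1.
Proof. by case: i => [[|[|//]] ?]; [left | right]; apply: val_inj. Qed.

Lemma sum2E (F : 'I_2 -> R) : \sum_i F i = F 0 + F 1.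
Proof. by rewrite !big_ord_recl big_ord0 addr0; congr (_ + F _); apply: val_inj. Qed.

Lemma mx2E M : M = mx2 (M 0 0) (M 0 1) (M 1 0) (M 1 1).
Proof. by apply/matrixP => i j; rewrite mxE; case: (ord2P i) => ->; case: (ord2P j) => ->. Qed.

Lemma rv2E (v : 'rV[R]_2) : v = rv2 (v 0 0) (v 0 1).
Proof. by apply/rowP => j; rewrite mxE; case: (ord2P j) => ->. Qed.

Lemma rv2_0 : rv2 0 0 = 0.
Proof. by apply/rowP => j; rewrite !mxE; case: ifP. Qed.

Lemma row0_mx2 a b c d : row 0 (mx2 a b c d) = rv2 a b.
Proof. by apply/rowP => j; rewrite !mxE. Qed.

Lemma row1_mx2 a b c d : row 1 (mx2 a b c d) = rv2 c d.
Proof. by apply/rowP => j; rewrite !mxE. Qed.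

Lemma rv2Z c x y : c *: rv2 x y = rv2 (c * x) (c * y).
Proof. by apply/rowP => j; rewrite !mxE; case: ifP. Qed.

Lemma rv2D x y x' y' : rv2 x y + rv2 x' y' = rv2 (x + x') (y + y').
Proof. by apply/rowP => j; rewrite !mxE; case: ifP. Qed.

Lemma mulmx2 a b c d a' b' c' d' : mx2 a b c d *m mx2 a' b' c' d' =
  mx2 (a * a' + b * c') (a * b' + b * d') (c * a' + d * c') (c * b' + d * d').
Proof.
apply/matrixP => i j; rewrite !mxE sum2E !mxE /=.
by case: (ord2P i) => ->; case: (ord2P j) => ->.
Qed.

Lemma mulrv2 x y a b c d :
  rv2 x y *m mx2 a b c d = rv2 (x * a + y * c) (x * b + y * d).
Proof. by apply/rowP => j; rewrite !mxE sum2E !mxE /=; case: (ord2P j) => ->. Qed.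

Lemma mx2_1 : mx2 1 0 0 1 = 1%:M.
Proof. by apply/matrixP => i j; rewrite !mxE; case: (ord2P i) => ->; case: (ord2P j) => ->. Qed.

Lemma det_mx2 a b c d : \det (mx2 a b c d) = a * d - b * c.
Proof.
rewrite (expand_det_row _ 0) sum2E !mxE /= /cofactor !det_mx11 !mxE /=.
by rewrite !addn0 addn1 expr0 expr1 mul1r mulN1r mulrN.
Qed.

Lemma mulmx_entry M N i j : (M *m N) i j = M i 0 * N 0 j + M i 1 * N 1 j.
Proof. by rewrite mxE sum2E. Qed.

End Matrices2.

(** * The groups GL(2, O_K) and Gamma_0 *)

Section GL2.
Variable K : fieldExtType rat.
Implicit Types (M N : 'M[K]_2).

Lemma integral_mx2 a b c d : integral_mx (mx2 a b c d : 'M[K]_2) <->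
  [/\ 'O_K a, 'O_K b, 'O_K c & 'O_K d].
Proof.
split=> [h|[aO bO cO dO] i j]; last first.
  by rewrite mxE; case: (ord2P i) => ->; case: (ord2P j) => ->.
by split; [have := h 0 0|have := h 0 1|have := h 1 0|have := h 1 1]; rewrite mxE.
Qed.

Lemma integral_mulmx m n l (M : 'M[K]_(m, n)) (N : 'M[K]_(n, l)) :
  integral_mx M -> integral_mx N -> integral_mx (M *m N).
Proof. by move=> Mi Ni i j; rewrite mxE; apply: Osum => k _; apply: OM; [exact: Mi | exact: Ni]. Qed.

Lemma integral_mx1 n : integral_mx (1%:M : 'M[K]_n).
Proof. by move=> i j; rewrite mxE; exact: (intO K (i == j)). Qed.

Lemma GL2P M : GL2_integers K M <-> exists N, [/\ integral_mx M, integral_mx N & M *m N = 1%:M].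
Proof.
split=> [[Mi Mu Mi']|[N [Mi Ni MN]]]; first by exists (invmx M); rewrite mulmxV.
have [Mu _] := mulmx1_unit MN; split=> //.
by rewrite -[invmx M]mulmx1 -MN mulKmx.
Qed.

Lemma GL2_unit M : GL2_integers K M -> M \in unitmx. Proof. by case. Qed.

Lemma GL2_integral M : GL2_integers K M -> integral_mx M. Proof. by case. Qed.

Lemma GL2_1 : GL2_integers K 1%:M.
Proof. by apply/GL2P; exists 1%:M; rewrite mulmx1; split=> //; exact: integral_mx1. Qed.

Lemma GL2_mul M N : GL2_integers K M -> GL2_integers K N -> GL2_integers K (M *m N).
Proof.
move=> /GL2P[M' [Mi M'i MM']] /GL2P[N' [Ni N'i NN']]; apply/GL2P; exists (N' *m M').
by split; try exact: integral_mulmx; rewrite mulmxA -(mulmxA M) NN' mulmx1.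
Qed.

Lemma GL2_inv M : GL2_integers K M -> GL2_integers K (invmx M).
Proof. by case=> Mi Mu Mi'; split; rewrite ?invmxK ?unitmx_inv. Qed.

Lemma GL2_det_unit M : GL2_integers K M -> 'O_K (\det M)^-1.
Proof.
case=> Mi Mu; rewrite -det_inv (mx2E (invmx M)) => /integral_mx2[aO bO cO dO].
by rewrite det_mx2; apply: OB; exact: OM.
Qed.

Lemma GL2_det1 a b c d : 'O_K a -> 'O_K b -> 'O_K c -> 'O_K d -> a * d - b * c = 1 ->
  GL2_integers K (mx2 a b c d).
Proof.
move=> aO bO cO dO E; apply/GL2P; exists (mx2 d (- b) (- c) a); split.
- exact/integral_mx2.
- by apply/integral_mx2; split=> //; exact: ON.
- rewrite mulmx2 -mx2_1; congr mx2; rewrite -?[RHS]E; ring.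
Qed.

Lemma Gamma0_1 (b : set K) : integral_ideal b -> Gamma0 b 1%:M.
Proof.
move=> bi; split; first exact: GL2_1.
by rewrite /= mxE mulr0n; apply: Omod0; exact: ideal_Omod.
Qed.

Lemma Gamma0_mul (b : set K) M N : integral_ideal b -> Gamma0 b M -> Gamma0 b N -> Gamma0 b (M *m N).
Proof.
move=> bi [Mg bM] [Ng bN]; split; first exact: GL2_mul.
have bm := ideal_Omod bi; rewrite mulmx_entry; apply: OmodD => //.
  by rewrite mulrC; apply: OmodM => //; exact: GL2_integral.
by apply: OmodM => //; exact: GL2_integral.
Qed.

(** The inverse is passed explicitly, so that for matrices in GL(2, O_K) membership in a coset of
    [Gamma0] becomes a condition on the lower left entry of [M *m c']. *)
Lemma coset_memP (H : set 'M[K]_2) (M c c' : 'M[K]_2) : c *m c' = 1%:M ->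
  [set h *m c | h in H] M <-> H (M *m c').
Proof.
move=> cc'; have c'c := mulmx1C cc'; split=> [[h Hh <-]|HM].
  by rewrite -mulmxA cc' mulmx1.
by exists (M *m c') => //; rewrite -mulmxA c'c mulmx1.
Qed.

Definition lowmx (x : K) : 'M[K]_2 := mx2 1 0 x 1.

Lemma lowmxV x : lowmx x *m lowmx (- x) = 1%:M.
Proof. by rewrite mulmx2 -mx2_1; congr mx2; ring. Qed.

Lemma Gamma0_lowmx c x : integral_ideal c -> c x -> Gamma0 c (lowmx x).
Proof.
move=> ci cx; split; last by rewrite mxE.
by apply: GL2_det1; [exact: O1|exact: O0|exact: ideal_O cx|exact: O1|ring].
Qed.

Lemma coprime_split (c p : set K) : prime_ideal p -> integral_ideal c -> ~ c `<=` p ->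
  exists x y, [/\ c x, p y & x + y = 1].
Proof.
move=> pp ci /existsNP[x /not_implyP[cx npx]].
have cm := ideal_Omod ci; have xO := ideal_O ci cx.
have [y yO pxy] := prime_maximal pp xO npx.
exists (x * y), (- (x * y - 1)); split; last ring.
  by rewrite mulrC; apply: OmodM.
by apply: OmodN => //; exact/ideal_Omod/prime_integral.
Qed.

(* The matrices of Gamma0 c with last entry invertible mod p are split by
   the matrices [1, 0; x, 1] with x in c / p c; when p does not divide c, the
   others form one more coset. *)
Lemma Gamma0_prime_reps (c p : set K) : prime_ideal p -> integral_ideal c ->
  exists s : seq 'M[K]_2, [/\ uniq s, (size s)%:R * psi c = psi (idealM p c),
    right_coset_reps (Gamma0 (idealM p c)) (Gamma0 c) [set` s]
    & forall t, t \in s -> \det t = 1].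
Proof.
move=> pp ci; have pi := prime_integral pp; have pm := ideal_Omod pi; have cm := ideal_Omod ci.
have pci := idealM_ideal pi ci; have pcm := ideal_Omod pci.
have pcp : idealM p c `<=` p by exact: idealM_subl.
have pcc : idealM p c `<=` c by exact: idealM_subr.
have [r [rc rinj rsurj]] := transversal_prime pp ci.
have rO i := ideal_O ci (rc i).
pose s0 := [seq lowmx (r i) | i <- enum 'I_(ideal_norm p)].
have us0 : uniq s0.
  rewrite map_inj_uniq ?enum_uniq // => i j /matrixP/(_ 1 0); rewrite !mxE /= => rij.
  by apply: rinj; rewrite rij subrr; exact: Omod0.
have sz0 : size s0 = ideal_norm p by rewrite size_map size_enum_ord.
have s0P t : t \in s0 -> exists i, t = lowmx (r i).
  by case/mapP => i _ ->; exists i.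
have s0in i : lowmx (r i) \in s0 by apply: map_f; rewrite mem_enum.
have s0c t : t \in s0 -> Gamma0 c t by case/s0P => i ->; exact: Gamma0_lowmx.
have s0d t : t \in s0 -> \det t = 1 by case/s0P => i ->; rewrite det_mx2; ring.
have lowE (M : 'M[K]_2) i : Gamma0 c M ->
    [set h *m lowmx (r i) | h in Gamma0 (idealM p c)] M <-> idealM p c (M 1 0 - M 1 1 * r i).
  move=> [Mg Mc]; rewrite (coset_memP _ _ (lowmxV _)) /Gamma0 /=.
  have -> : (M *m lowmx (- r i)) 1 0 = M 1 0 - M 1 1 * r i by rewrite mulmx_entry !mxE /=; ring.
  split=> [[]//|h]; split=> //.
  apply: GL2_mul => //; case: (@Gamma0_lowmx c (- r i)) => //; exact: OmodN.
(* Here [M 1 1] is a unit modulo p with inverse z, which forces the representative to be that of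
   [z * M 1 0] modulo p c. *)
have low1 (M : 'M[K]_2) : Gamma0 c M -> ~ p (M 1 1) ->
    exists i, forall j, [set h *m lowmx (r j) | h in Gamma0 (idealM p c)] M <-> j = i.
  move=> Mc np; have [Mg cM] := Mc; have yO := GL2_integral Mg 1 1.
  have [z zO pyz] := prime_maximal pp yO np.
  have [i ri] := rsurj _ (OmodM cm zO cM); exists i => j.
  have pci1 : idealM p c (M 1 0 - M 1 1 * r i).
    have -> : M 1 0 - M 1 1 * r i = M 1 1 * (z * M 1 0 - r i) - (M 1 1 * z - 1) * M 1 0 by ring.
    by apply: OmodB => //; [exact: OmodM | exact: idealM_mem].
  rewrite lowE //; split=> [pcj|-> //]; apply: rinj.
  have -> : r j - r i = z * ((M 1 0 - M 1 1 * r i) - (M 1 0 - M 1 1 * r j))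
     - (M 1 1 * z - 1) * (r j - r i) by ring.
  apply: OmodB => //; first by apply: OmodM => //; exact: OmodB.
  by apply: idealM_mem => //; exact: OmodB.
(* The bottom row cannot vanish modulo p, since the determinant is a unit. *)
have detp (M : 'M[K]_2) : GL2_integers K M -> p (M 1 0) -> p (M 1 1) -> False.
  move=> Mg p10 p11; apply: (prime_n1 pp).
  have -> : 1 = (\det M)^-1 * \det M :> K.
    by rewrite mulVf // -unitfE -unitmxE; exact: GL2_unit.
  apply: OmodM => //; first exact: GL2_det_unit.
  have MO := GL2_integral Mg.
  by rewrite (mx2E M) det_mx2; apply: OmodB => //; apply: OmodM => //; exact (MO _ _).
have [cp|ncp] := pselect (c `<=` p).
  exists s0; split=> //; first by rewrite sz0 psi_primeM_dvd.
  split=> [t|M Mc]; first exact: s0c.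
  have np : ~ p (M 1 1) by case: (Mc) => Mg cM; apply: detp Mg _; exact: cp.
  have [i iP] := low1 M Mc np; exists (lowmx (r i)); split.
    by split; [exact: s0in | apply/iP].
  by move=> t [/s0P[j ->] /iP ->].
have [x0 [y0 [cx0 py0 xy]]] := coprime_split pp ci ncp.
have x0O := ideal_O ci cx0; have y0O := ideal_O pi py0.
(* [W] has determinant x0 + y0 = 1, lower left entry x0 in c and last entry y0 in p: it represents
   the coset of the matrices with [M 1 1] in p. *)
pose W : 'M[K]_2 := mx2 1 (- 1) x0 y0.
have WV : W *m mx2 y0 1 (- x0) 1 = 1%:M.
  by rewrite mulmx2 -mx2_1; congr mx2; rewrite -?[RHS]xy; ring.
have O1' := O1 K; have ON1 := ON O1'.
have Wc : Gamma0 c W.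
  split; last by rewrite mxE.
  by apply: GL2_det1 => //; rewrite -[RHS]xy; ring.
have WE (M : 'M[K]_2) : Gamma0 c M ->
    [set h *m W | h in Gamma0 (idealM p c)] M <-> p (M 1 1).
  move=> Mc; have [Mg cM] := Mc; have MO := GL2_integral Mg.
  rewrite (coset_memP _ _ WV) /Gamma0 /=.
  have -> : (M *m mx2 y0 1 (- x0) 1) 1 0 = M 1 0 * y0 - M 1 1 * x0.
    by rewrite mulmx_entry !mxE /=; ring.
  split=> [[_ /pcp h]|p11].
    have -> : M 1 1 = M 1 1 * y0 + M 1 0 * y0 - (M 1 0 * y0 - M 1 1 * x0).
      by rewrite -[LHS]mulr1 -xy; ring.
    by apply: OmodB => //; apply: OmodD => //; apply: OmodM.
  split; first by apply: GL2_mul => //; apply: GL2_det1 => //; [exact: ON | rewrite -[RHS]xy; ring].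
  apply: OmodB => //; last exact: idealM_mem.
  by rewrite mulrC; exact: idealM_mem.
exists (W :: s0); split.
- rewrite /= us0 andbT; apply/negP => /s0P[i Wi].
  have /matrixP/(_ 0 1) := Wi; rewrite !mxE /= => /eqP; rewrite oppr_eq0 oner_eq0 //.
- by rewrite /= sz0 psi_primeM_ndvd // addn1.
- split=> [t|M Mc] /=; first by rewrite inE => /orP[/eqP->|]; [exact: Wc | exact: s0c].
  have [p11|np] := pselect (p (M 1 1)).
    exists W; split; first by split; [rewrite inE eqxx | exact/WE].
    move=> t [+ tM]; rewrite inE => /orP[/eqP-> //|/s0P[i ti]].
    move: tM; rewrite ti => /(lowE M i Mc) /pcp h.
    have [Mg cM] := Mc; case: (detp M) => //.
    rewrite -(subrK (M 1 1 * r i) (M 1 0)); apply: OmodD => //.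
    by rewrite mulrC; apply: OmodM.
  have [i iP] := low1 M Mc np; exists (lowmx (r i)); split.
    by split; [rewrite inE s0in orbT | apply/iP].
  move=> t [+ tM]; rewrite inE => /orP[/eqP tW|/s0P[j tj]].
    by case: np; apply/WE => //; rewrite -tW.
  by move: tM; rewrite tj => /iP ->.
- move=> t; rewrite inE => /orP[/eqP->|]; last exact: s0d.
  by rewrite det_mx2 -[RHS]xy; ring.
Qed.

(** M determines its representative y modulo [H2], then the element of [H2] left over, then the
    representative x of that element modulo [H1]; so indices multiply along the chain. *)
Lemma right_coset_repsM (H1 H2 G : set 'M[K]_2) (s t : seq 'M[K]_2) :
  (forall M, H2 M -> M \in unitmx) ->
  (forall M, G M -> M \in unitmx) ->
  (forall M N, G M -> G N -> G (M *m N)) ->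
  (forall M N, H2 M -> H2 N -> H2 (M *m N)) ->
  H2 1%:M -> H1 `<=` H2 -> H2 `<=` G -> uniq s -> uniq t ->
  right_coset_reps H1 H2 [set` s] -> right_coset_reps H2 G [set` t] ->
  uniq [seq x *m y | x <- s, y <- t] /\
  right_coset_reps H1 G [set` [seq x *m y | x <- s, y <- t]].
Proof.
move=> uH2 uG GM H2M H21 H12 H2G us ut [sH2 sP] [tG tP].
have tuniq M x y x' y' : H2 x -> H2 x' -> y \in t -> y' \in t -> G M ->
    M = x *m y -> M = x' *m y' -> x = x' /\ y = y'.
  move=> Hx Hx' yt y't GMM E E'; have [z [_ zu]] := tP M GMM.
  have yy : y = y'.
    rewrite -(zu y); last by split=> //; exists x.
    by rewrite -(zu y') //; split=> //; exists x'.
  split=> //; move: E'; rewrite E -yy => /(congr1 (mulmxr (invmx y))) /=.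
  by rewrite -!mulmxA mulmxV ?mulmx1 //; apply/uG/tG.
have sG x : x \in s -> G x by move=> xs; exact/H2G/sH2.
split.
  apply: allpairs_uniq => // -[x y] [x' y'] /= /allpairsP[[x1 y1] [/= xs yt [-> ->]]].
  move=> /allpairsP[[x2 y2] [/= xs' yt' [-> ->]]] E.
  by have [-> ->] := tuniq _ _ _ _ _ (sH2 _ xs) (sH2 _ xs') yt yt' (GM _ _ (sG _ xs) (tG _ yt)) erefl E.
split=> [_ /allpairsP[[x y] [/= xs yt ->]]|M MG].
  by apply: GM; [exact: sG | exact: tG].
have [y [[yt [h Hh hy]] yu]] := tP M MG.
have [x [[xs [k Hk kx]] xu]] := sP h Hh.
exists (x *m y); split.
  split; first by apply/allpairsP; exists (x, y).
  by exists k => //; rewrite mulmxA kx.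
move=> _ [/allpairsP[[x' y'] [/= xs' yt' ->]] [k' Hk' k'E]].
have H2kx : H2 (k' *m x') by apply: H2M; [exact: H12 | exact: sH2].
have [hE ->] : h = k' *m x' /\ y = y'.
  by apply: (tuniq M) => //; rewrite -k'E mulmxA.
by rewrite (xu x') //; split=> //; exists k'.
Qed.

Lemma Gamma0_O : Gamma0 ('O_K : set K) = GL2_integers K.
Proof.
by apply/seteqP; split=> [M []//|M Mg]; split=> //; exact: GL2_integral.
Qed.

Lemma Gamma0_reps (b : set K) : integral_ideal b ->
  exists s : seq 'M[K]_2, [/\ uniq s, (size s)%:R = psi b,
    right_coset_reps (Gamma0 b) (GL2_integers K) [set` s]
    & forall t, t \in s -> \det t = 1].
Proof.
move: {2}(ideal_norm b).+1 (ltnSn (ideal_norm b)) => n; elim: n b => // n IH b lt bi.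
have [->|bO] := pselect (b = 'O_K).
  exists [:: 1%:M]; split=> //; [by rewrite psi_O| |by move=> t; rewrite inE => /eqP->; exact: det1].
  split=> [t|M Mg] /=; first by rewrite inE => /eqP->; exact: GL2_1.
  exists 1%:M; split; last by move=> t [+ _]; rewrite inE => /eqP.
  split; first by rewrite inE.
  by exists M; rewrite ?mulmx1 ?Gamma0_O.
have [p pp bp] := prime_above bi bO; have pi := prime_integral pp.
have [c ci bE] := sub_dvd pi bi bp.
have cb : (ideal_norm c < ideal_norm b)%N.
  apply: ideal_norm_lt => //; first by rewrite bE; exact: idealM_subr.
  move=> bc; apply: (prime_n1 pp); suff -> : p = 'O_K by exact: O1.
  apply: (idealM_inj ci); [exact: ideal_Omod | exact: Omod_O|].
  by rewrite (idealM1 (ideal_Omod ci)) idealMC -bE.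
have [t [ut tpsi tP tdet]] := IH c (leq_trans cb lt) ci.
have [s [us spsi sP sdet]] := Gamma0_prime_reps pp ci.
rewrite bE; exists [seq x *m y | x <- s, y <- t].
have [||||||//|//|//|//|//|u P] := @right_coset_repsM (Gamma0 (idealM p c)) (Gamma0 c) (GL2_integers K) s t.
- by move=> M [/GL2_unit].
- exact: GL2_unit.
- exact: GL2_mul.
- by move=> M N; exact: Gamma0_mul.
- exact: Gamma0_1.
- by move=> M [Mg h]; split=> //; exact: (idealM_subr pi ci).
- by move=> M [].
split=> //; first by rewrite size_allpairs natrM tpsi.
by move=> _ /allpairsP[[x y] [/= xs yt ->]]; rewrite det_mulmx sdet // tdet // mulr1.
Qed.

End GL2.

(** * Matrices with prescribed row lattice *)

Section IdealPair.
Variable K : fieldExtType rat.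
Implicit Types (a b p : set K).

(** Write J = E I; a proper I would lie in a prime p, and J in p E. This stands in for a comparison
    at each localization. *)
Lemma ideal_eq_local (E J : set K) : integral_ideal E -> integral_ideal J -> J `<=` E ->
  (forall p, prime_ideal p -> ~ J `<=` idealM p E) -> J = E.
Proof.
move=> Ei Ji JE np; have [I Ii JEI] := sub_dvd Ei Ji JE.
have [IO|IO] := pselect (I = 'O_K); first by rewrite JEI IO idealM1 //; exact: ideal_Omod.
have [p pp Ip] := prime_above Ii IO; case: (np p pp).
by rewrite JEI idealMC; apply: idealMS.
Qed.

Lemma submodule_Omod a : Omodule a -> @submodule K K^o a.
Proof. by case. Qed.

(** The conclusion says that the integral ideal w d^-1 is prime to z. The primes containing z are
    finite in number, so avoidance applies to d and its submodules p d. *)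
Lemma coprime_element (d : set K) z : integral_ideal d -> 'O_K z -> z != 0 ->
  exists2 w, d w & forall p, prime_ideal p -> p z -> ~ idealM p d w.
Proof.
move=> di zO z0; have [s sP] := primes_over (principal_ideal_ideal zO z0).
have [|p /sP[]//|p /sP[pp _]|p c u _ pc du|p /sP[pp _]|w dw wP] :=
  @prime_avoidance K K^o d (fun p => idealM p d) s.
- exact/submodule_Omod/ideal_Omod.
- apply: submodule_Omod; apply: idealM_Omod; apply: ideal_Omod; exact: prime_integral.
- exact: idealM_mem.
- exact: prime_idealM_proper.
exists w => // p pp pz; apply: wP; apply/sP; split=> // _ [c cO <-].
by apply: OmodM => //; exact/ideal_Omod/prime_integral.
Qed.

Lemma dsumE a b x y : dsum a b (rv2 x y) <-> a x /\ b y.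
Proof. by rewrite /dsum /= !mxE. Qed.

(* A bottom row (z, w) with z c^-1 + w d^-1 = 'O_K extends to determinant beta. *)
Lemma ideal_pair_exists (c d : set K) beta : integral_ideal c -> integral_ideal d ->
  idealM c d = principal_ideal beta ->
  exists B, ideal_pair_mx c d B /\ \det B = beta.
Proof.
move=> ci di cdE; have cm := ideal_Omod ci; have dm := ideal_Omod di.
have cdi := idealM_ideal ci di.
have [z cz z0] : exists2 z, c z & z != 0 by case: ci.
have zO := ideal_O ci cz.
have [w dw wP] := coprime_element di zO z0.
have wO := ideal_O di dw.
(* J is c d times z c^-1 + w d^-1, so J = c d expresses that the bottom row (z, w) is unimodular
   relative to c and d. *)
pose J := idealD (idealM (principal_ideal z) d) (idealM (principal_ideal w) c).
have Jm : Omodule J.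
  by apply: idealD_Omod; apply: idealM_Omod; exact: principal_Omod.
have zdJ : idealM (principal_ideal z) d `<=` J.
  by apply: idealD_subl; apply: idealM_Omod; exact: principal_Omod.
have wcJ : idealM (principal_ideal w) c `<=` J.
  by apply: idealD_subr; apply: idealM_Omod; exact: principal_Omod.
have Jcd : J `<=` idealM c d.
  apply: idealD_sub; first exact: ideal_Omod.
    by apply: idealMS => // _ [u uO <-]; exact: OmodM.
  by rewrite idealMC; apply: idealMS => // _ [u uO <-]; exact: OmodM.
have Ji : integral_ideal J.
  apply: idealI => //; first by move=> x /Jcd; exact: ideal_O.
  case: (di) => _ _ _ _ [y dy y0]; exists (z * y); last by rewrite mulf_neq0.
  by apply: zdJ; apply: idealM_mem => //; exact: principal_mem.
have JE : J = idealM c d.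
  apply: ideal_eq_local => // p pp Jp; have pi := prime_integral pp.
  have pm := ideal_Omod pi.
  have [pz|npz] := pselect (p z).
    apply: (wP p pp pz).
    suff : principal_ideal w `<=` idealM p d by apply; exact: principal_mem.
    apply: (idealM_subI ci); [exact: principal_Omod | exact: idealM_Omod|].
    by rewrite idealMC -(idealMCA p); exact: subset_trans wcJ Jp.
  apply: npz; apply: (idealM_subl pi ci).
  suff : principal_ideal z `<=` idealM p c by apply; exact: principal_mem.
  apply: (idealM_subI di); [exact: principal_Omod | exact: idealM_Omod|].
  by rewrite idealMC -(idealMCA p) (idealMC d c); exact: subset_trans zdJ Jp.
have : J beta by rewrite JE cdE; exact: principal_mem.
(* A decomposition of beta in z d + w c provides the top row. *)
rewrite /J !idealM_principalE // => -[_ [_ [[y' dy' <-] [x cx <-] betaE]]].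
pose y := - y'; have dy : d y by exact: OmodN.
have xO := ideal_O ci cx; have yO := ideal_O di dy.
have dE : x * w - y * z = beta by rewrite betaE /y; ring.
exists (mx2 x y z w); split; last by rewrite det_mx2.
split; first exact/integral_mx2.
have beta0 : beta != 0.
  case: cdi => _ _ _ _ [u + u0]; rewrite cdE => -[t tO tE].
  by apply: contraNneq u0 => b0; rewrite -tE b0 mulr0.
have inO u : idealM c d u -> 'O_K (u / beta) by rewrite cdE => /principalP; apply.
apply/seteqP; split=> [_ [v [v0 v1] <-]|v [cv0 dv1]].
  rewrite (rv2E v) mulrv2; apply/dsumE; split; first by apply: OmodD => //; exact: OmodM.
  by apply: OmodD => //; exact: OmodM.
(* Cramer's rule: the entries of v times the adjugate lie in c d = (beta), so dividing by beta
   leaves them integral. *)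
exists (rv2 ((v 0 0 * w - v 0 1 * z) / beta) ((- v 0 0 * y + v 0 1 * x) / beta)).
  apply/dsumE; split; apply: inO.
    apply: OmodB; [exact: ideal_Omod | exact: idealM_mem | by rewrite mulrC; exact: idealM_mem].
  apply: OmodD; [exact: ideal_Omod | by apply: idealM_mem => //; exact: OmodN | by rewrite mulrC; exact: idealM_mem].
rewrite mulrv2 [RHS]rv2E -dE; congr rv2; field; by rewrite dE.
Qed.

End IdealPair.

(** * Elementary divisors of lattices *)

Section Lattices.
Variable K : fieldExtType rat.
Implicit Types (a b p : set K) (M : set 'rV[K]_2).

Lemma submodule_dsum a b : Omodule a -> Omodule b -> submodule (dsum a b).
Proof.
move=> am bm; split.
- by split; rewrite mxE; exact: Omod0.
- by move=> u v [au bu] [av bv]; split; rewrite mxE; exact: OmodD.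
- by move=> c u cO [au bu]; split; rewrite mxE; exact: OmodM.
Qed.

Lemma latmul_GL2 (M : set 'rV[K]_2) (g : 'M[K]_2) v : g \in unitmx ->
  latmul M g v <-> M (v *m invmx g).
Proof.
move=> gu; split=> [[u Mu <-]|Mv]; first by rewrite mulmxK.
by exists (v *m invmx g) => //; rewrite mulmxKV.
Qed.

Lemma integral_dsum (v : 'rV[K]_2) : dsum 'O_K 'O_K v <-> integral_mx v.
Proof.
split=> [[v0 v1] i j|h]; last by split; exact: h.
by rewrite (ord1 i); case: (ord2P j) => ->.
Qed.

(* By avoidance, some v in M lies outside p L for each p | m; after making its
   first entry c nonzero, adding a multiple t m to the second one, with t
   divisible by exactly those p | c that do not divide it, makes v unimodular. *)
Lemma unimodular_vector (M : set 'rV[K]_2) m : submodule M -> M `<=` dsum 'O_K 'O_K ->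
  'O_K m -> m != 0 -> (forall v, dsum 'O_K 'O_K v -> M (m *: v)) ->
  (forall p, prime_ideal p -> ~ M `<=` dsum p p) ->
  exists c d x y, [/\ M (rv2 c d), 'O_K x, 'O_K y & x * c + y * d = 1].
Proof.
move=> Mm ML mO m0 mM Mp; have [M0 MD MZ] := Mm.
have [s sP] := primes_over (principal_ideal_ideal mO m0).
have pm p : prime_ideal p -> Omodule p by move=> pp; exact/ideal_Omod/prime_integral.
have sE p : p \in s <-> prime_ideal p /\ p m.
  rewrite sP; split=> -[pp h]; split=> //; first exact/h/principal_mem.
  by move=> _ [c cO <-]; apply: OmodM => //; exact: pm.
have [|||||v Mv vP] := @prime_avoidance K _ M (fun p => dsum p p) s.
- exact: Mm.
- by move=> p /sE[].
- by move=> p /sE[pp _]; apply: submodule_dsum; exact: pm.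
- move=> p c u /sE[pp _] pc /ML[u0 u1].
  by split; rewrite mxE mulrC; apply: OmodM => //; exact: pm.
- move=> p /sE[pp _]; apply: contrapT => no; apply: (Mp p pp) => u Mu.
  by apply: contrapT => nu; apply: no; exists u.
have e0O : dsum 'O_K 'O_K (rv2 (1 : K) 0) by apply/dsumE; split; [exact: O1 | exact: O0].
have e1O t : 'O_K t -> dsum 'O_K 'O_K (rv2 (0 : K) t) by move=> tO; apply/dsumE; split=> //; exact: O0.
(* If the first entry is 0, it is replaced by m, which leaves v unchanged modulo the primes that
   contain m. *)
have {v Mv vP} [c [d [c0 Mcd cdP]]] : exists c d, [/\ c != 0, M (rv2 c d) &
    forall p, prime_ideal p -> p m -> p c -> p d -> False].
  have [v0|v0] := eqVneq (v 0 0) 0; last first.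
    exists (v 0 0), (v 0 1); split=> //; first by rewrite -rv2E.
    by move=> p pp pm' p0 p1; apply: (vP p) => //; exact/sE.
  exists m, (v 0 1); split=> //.
    have -> : rv2 m (v 0 1) = m *: rv2 1 0 + v.
      by apply/rowP => j; rewrite !mxE; case: (ord2P j) => -> /=; rewrite ?v0; ring.
    by apply: MD => //; exact: mM.
  move=> p pp pm' p0 p1; apply: (vP p); first exact/sE.
  by split=> //; rewrite v0; exact: Omod0 (pm _ pp).
have [cO dO] : 'O_K c /\ 'O_K d by apply/dsumE/ML.
have [s' s'P] := primes_over (principal_ideal_ideal cO c0).
have s'E p : p \in s' <-> prime_ideal p /\ p c.
  rewrite s'P; split=> -[pp h]; split=> //; first exact/h/principal_mem.
  by move=> _ [u uO <-]; apply: OmodM => //; exact: pm.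
(* The primes in [s1] contain c and d, hence not m, so m t with t outside them repairs the second
   entry. Those in [s2] contain c but not d, and t must lie in them to leave the second entry
   alone. *)
pose s1 := [seq p <- s' | `[< p d >]]; pose s2 := [seq p <- s' | ~~ `[< p d >]].
have s1E p : p \in s1 -> [/\ prime_ideal p, p c & p d].
  by rewrite mem_filter => /andP[/asboolP pd /s'E[]].
have s2E p : p \in s2 -> [/\ prime_ideal p, p c & ~ p d].
  by rewrite mem_filter => /andP[/asboolPn pd /s'E[]].
have s2p p : p \in s2 -> prime_ideal p by case/s2E.
have [|||||t t2 t1] := @prime_avoidance K K^o (idealprod s2) id s1.
- by apply: submodule_Omod; exact/ideal_Omod/idealprod_ideal.
- by move=> p /s1E[].
- by move=> p /s1E[pp _ _]; apply: submodule_Omod; exact: pm.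
- move=> p u w /s1E[pp _ _] pu sw; rewrite -[_ *: _]/(u * w) mulrC; apply: OmodM => //; first exact: pm.
  by apply: ideal_O sw; exact: idealprod_ideal.
- move=> p /s1E[pp pc pd]; apply: contrapT => no.
  have /s2E[_ _ []//] : p \in s2.
  apply: prime_idealprod => // u su.
  by apply: contrapT => nu; apply: no; exists u.
have tO : 'O_K t by apply: ideal_O t2; exact: idealprod_ideal.
have t2p p : p \in s2 -> p t.
  move=> ps; have := t2; rewrite (idealprod_rem ps); apply: idealM_subl.
    by apply: prime_integral; exact: s2p.
  by apply: idealprod_ideal => q /mem_rem; exact: s2p.
pose u := d + m * t.
have uO : 'O_K u by apply: OD => //; exact: OM.
have Mcu : M (rv2 c u).
  have -> : rv2 c u = rv2 c d + m *: rv2 0 t.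
    by apply/rowP => j; rewrite !mxE; case: (ord2P j) => -> /=; rewrite /u; ring.
  by apply: MD => //; apply: mM; exact: e1O.
have cop p : prime_ideal p -> p c -> ~ p u.
  move=> pp pc pu; have pi := pm _ pp; have ps' : p \in s' by exact/s'E.
  have [pd|npd] := pselect (p d).
    have ps1 : p \in s1 by rewrite mem_filter ps' andbT; apply/asboolP.
    have : p (m * t) by have -> : m * t = u - d; [rewrite /u; ring | exact: OmodB].
    case: (pp) => _ _ h /(h _ _ mO tO)[pm'|]; first exact: (cdP p).
    exact: t1.
  have ps2 : p \in s2 by rewrite mem_filter ps' andbT; apply/asboolPn.
  apply: npd; have -> : d = u - m * t by rewrite /u; ring.
  by apply: OmodB => //; apply: OmodM => //; exact: t2p.
pose J := idealD (principal_ideal c) (principal_ideal u).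
have Ji : integral_ideal J.
  apply: idealD_ideal; [exact: principal_ideal_ideal | exact: principal_Omod | exact: principal_subO].
have [JO|JO] := pselect (J = 'O_K).
  have : J 1 by rewrite JO; exact: O1.
  by move=> [_ [_ [[x xO <-] [y yO <-] E]]]; exists c, u, x, y.
have [p pp Jp] := prime_above Ji JO; case: (cop p pp); apply: Jp.
  by apply: idealD_subl; [exact: principal_Omod | exact: principal_mem].
by apply: idealD_subr; [exact: principal_Omod | exact: principal_mem].
Qed.

(** The ideal generated by the coordinates of the vectors of M; the product with ['O_K] supplies
    multiples and sums. *)
Definition content M : set K :=
  idealM 'O_K [set x | exists2 v, M v & x = v 0 0 \/ x = v 0 1].

Lemma content_mem M v : M v -> content M (v 0 0) /\ content M (v 0 1).
Proof.
by move=> Mv; split; rewrite -[v _ _]mul1r; apply: idealM_mem;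
   [exact: O1 | exists v; auto | exact: O1 | exists v; auto].
Qed.

Lemma content_sub M a : Omodule a -> (forall v, M v -> dsum a a v) -> content M `<=` a.
Proof.
move=> am Ma; apply: idealM_subO => // x _ xO [v /Ma[v0 v1] [->|->]];
exact: OmodM.
Qed.

(* With d the content of M, the lattice d^-1 M has content 'O_K, so it contains
   a unimodular vector; taking it as the second basis vector of 'O_K (+) 'O_K
   makes d^-1 M of the form c1 (+) 'O_K. *)
Lemma lattice_elementary_divisors (M : set 'rV[K]_2) m :
  submodule M -> M `<=` dsum 'O_K 'O_K ->
  'O_K m -> m != 0 -> (forall v, dsum 'O_K 'O_K v -> M (m *: v)) ->
  exists (c1 c2 : set K) g, [/\ integral_ideal c1, integral_ideal c2, GL2_integers K g
    & M = latmul (dsum (idealM c1 c2) c2) g].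
Proof.
move=> [M0 MD MZ] ML mO m0 mM.
have e0O : dsum 'O_K 'O_K (rv2 (1 : K) 0) by apply/dsumE; split; [exact: O1 | exact: O0].
pose d := content M; have dm : Omodule d by exact/idealM_Omod/Omod_O.
have di : integral_ideal d.
  apply: idealI => //; first by apply: content_sub; [exact: Omod_O | exact: ML].
  exists m => //; have [+ _] := content_mem (mM _ e0O).
  by rewrite rv2Z mxE /= mulr1.
(* This is d^-1 M, described by a colon condition instead of sums. *)
pose M' := [set v | forall x, d x -> M (x *: v)].
have M'm : submodule M'.
  split=> [x _|u v Mu Mv x dx|c u cO Mu x dx]; first by rewrite scaler0.
    by rewrite scalerDr; apply: MD; [exact: Mu | exact: Mv].
  by rewrite scalerA; apply: Mu; rewrite mulrC; exact: OmodM.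
have M'L : M' `<=` dsum 'O_K 'O_K.
  move=> v Mv; split; apply: (stable_integral di) => x dx; rewrite mulrC.
    by have [+ _] := content_mem (Mv x dx); rewrite mxE.
  by have [_] := content_mem (Mv x dx); rewrite mxE.
have VM' v y : M v -> idealV d y -> M' (y *: v).
  by move=> Mv Vy x dx; rewrite scalerA mulrC; apply: MZ => //; exact: Vy.
(* If M' were inside p L, multiplying the coordinates of M by d^-1 would put d d^-1 = ['O_K] inside
   p. *)
have M'p p : prime_ideal p -> ~ M' `<=` dsum p p.
  move=> pp sub; apply: (prime_n1 pp); have pm := ideal_Omod (prime_integral pp).
  have : idealM d (idealV d) 1 by rewrite idealMV //; exact: O1.
  apply: idealM_subO => // x y dx Vy; move: x dx; apply: content_sub.
    split; first by rewrite /= mul0r; exact: Omod0.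
      by move=> u v /=; rewrite mulrDl; exact: OmodD.
    by move=> c u cO /=; rewrite -mulrA; exact: OmodM.
  move=> v Mv; have [] := sub _ (VM' _ _ Mv Vy); rewrite !mxE => p0 p1.
  by split; rewrite /= mulrC.
have mM' v : dsum 'O_K 'O_K v -> M' (m *: v).
  by move=> vL x dx; apply: MZ; [exact: ideal_O dx | exact: mM].
have [c [u [x [y [Mw xO yO xy]]]]] := unimodular_vector M'm M'L mO m0 mM' M'p.
have [cO uO] : 'O_K c /\ 'O_K u by apply/dsumE/M'L.
pose g : 'M[K]_2 := mx2 y (- x) c u.
have gG : GL2_integers K g.
  by apply: GL2_det1 => //; [exact: ON | rewrite -xy; ring].
have gu := GL2_unit gG.
have gE (v1 v2 : K) : rv2 v1 v2 *m g = rv2 v1 0 *m g + v2 *: rv2 c u.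
  rewrite !mulrv2 rv2Z; apply/rowP => j; rewrite !mxE; case: ifP => _; ring.
(* The second row (c, u) of [g] lies in M', so in the basis [g] the lattice M' is b1 (+) ['O_K]. *)
pose b1 := [set v1 | M' (rv2 v1 0 *m g)].
have [M'0 M'D M'Z] := M'm.
have b1m : Omodule b1.
  split=> [|v w|t v tO]; rewrite /b1 /=.
  - by rewrite rv2_0 mul0mx.
  - move=> Mv' Mw'; have -> : rv2 (v + w) 0 *m g = rv2 v 0 *m g + rv2 w 0 *m g.
      by rewrite -mulmxDl rv2D addr0.
    exact: M'D.
  - move=> Mv'; have -> : rv2 (t * v) 0 *m g = t *: (rv2 v 0 *m g).
      by rewrite scalemxAl rv2Z mulr0.
    exact: M'Z.
have inL v : dsum 'O_K 'O_K v -> dsum 'O_K 'O_K (v *m invmx g).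
  move=> /integral_dsum vL; apply/integral_dsum; apply: integral_mulmx => //.
  by apply: GL2_integral; exact: GL2_inv.
have b1i : integral_ideal b1.
  apply: idealI => //.
    move=> v1 /M'L /inL; rewrite mulmxK // => /dsumE[]//.
  exists m => //; rewrite /b1 /=; have -> : rv2 m 0 *m g = m *: (rv2 1 0 *m g).
    by rewrite scalemxAl rv2Z mulr1 mulr0.
  apply: mM'; apply/integral_dsum; apply: integral_mulmx; last exact: GL2_integral.
  exact/integral_dsum.
exists b1, d, g; split=> //; apply/seteqP; split=> v.
  move=> Mv; apply/latmul_GL2 => //; set w := v *m invmx g.
  have vw : v = w *m g by rewrite mulmxKV.
  have yw t : idealV d t -> b1 (t * w 0 0) /\ 'O_K (t * w 0 1).
    move=> Vt; have h := VM' _ _ Mv Vt.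
    have tw : (t *: v) *m invmx g = rv2 (t * w 0 0) (t * w 0 1).
      by rewrite -scalemxAl -/w {1}[w]rv2E rv2Z.
    have twO : 'O_K (t * w 0 1) by have := inL _ (M'L _ h); rewrite tw => /dsumE[].
    split=> //; rewrite /b1 /=.
    have -> : rv2 (t * w 0 0) 0 *m g = t *: v + (- (t * w 0 1)) *: rv2 c u.
      have -> : t *: v = rv2 (t * w 0 0) (t * w 0 1) *m g.
        by rewrite -rv2Z -rv2E -scalemxAl -vw.
      by rewrite [in RHS]gE scaleNr addrK.
    by apply: M'D => //; apply: M'Z => //; exact: ON.
  (* 1 is a sum of products s t with s in d and t in d^-1; the facts known for t w are multiplied by
     s and added up. *)
  have : idealM d (idealV d) 1 by rewrite idealMV //; exact: O1.
  move=> h1; split.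
    rewrite -[w 0 0]mul1r; move: (1 : K) h1; apply: idealM_sub.
    - by rewrite mul0r; exact: idealM0.
    - by move=> s t hs ht; rewrite mulrDl; exact: idealMD.
    - move=> s t ds Vt; have [h _] := yw _ Vt.
      by rewrite -mulrA idealMC; exact: idealM_mem.
  rewrite -[w 0 1]mul1r; move: (1 : K) h1; apply: idealM_sub.
  - by rewrite mul0r; exact: Omod0.
  - by move=> s t hs ht; rewrite mulrDl; exact: OmodD.
  - move=> s t ds Vt; have [_ h] := yw _ Vt.
    by rewrite -mulrA mulrC; exact: OmodM.
move=> [w [w0 w1] <-]; rewrite (rv2E w) gE; apply: (MD); last exact: Mw.
move: (w 0 0) w0; apply: idealM_sub.
- by rewrite rv2_0 mul0mx.
- move=> s t hs ht; have -> : rv2 (s + t) 0 *m g = rv2 s 0 *m g + rv2 t 0 *m g.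
    by rewrite -mulmxDl rv2D addr0.
  exact: MD.
- move=> s t bs dt; have -> : rv2 (s * t) 0 *m g = t *: (rv2 s 0 *m g).
    by rewrite scalemxAl rv2Z mulr0 mulrC.
  exact: bs.
Qed.

(** Each term of the Leibniz expansion contains one factor from each of the two columns. *)
Lemma det_ideal_mem n (A : 'M[K]_n) (j1 j2 : 'I_n) (c1 c2 : set K) : j1 != j2 ->
  Omodule c1 -> (forall i j, 'O_K (A i j)) -> (forall i, c1 (A i j1)) -> (forall i, c2 (A i j2)) ->
  idealM c1 c2 (\det A).
Proof.
move=> j12 c1m AO A1 A2; have cm : Omodule (idealM c1 c2) by exact: idealM_Omod.
apply: Omod_sum => // s _; apply: OmodM => //; first by apply: OX; apply/ON/O1.
rewrite (bigD1 (s^-1 j1)%g) //= (bigD1 (s^-1 j2)%g) /=; last first.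
  by rewrite (inj_eq perm_inj) eq_sym.
rewrite !permKV mulrA mulrC; apply: OmodM => //; last exact: idealM_mem.
by elim/big_ind: _ => // [|u v]; [exact: O1 | exact: OM].
Qed.

Lemma dsum_mulmx (c1 c2 : set K) m n (P : 'M[K]_(m, n)) (Q : 'M[K]_(n, 2)) :
  Omodule c1 -> Omodule c2 -> integral_mx P -> (forall i, dsum c1 c2 (row i Q)) ->
  forall i, dsum c1 c2 (row i (P *m Q)).
Proof.
move=> c1m c2m PO QX i; split; rewrite !mxE; apply: Omod_sum => // k _;
by apply: OmodM => //; first exact (PO _ _);
  have [] := QX k; rewrite !mxE.
Qed.

(* A chain map between the two presentations turns diag(y1, y2) into a 4 x 4
   matrix of the same determinant, two of whose columns lie in c1 and c2: this
   is the invariance of Fitting ideals. *)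
Lemma fitting_sub (a1 a2 c1 c2 : set K) (F G : 'M[K]_2) :
  integral_ideal a1 -> integral_ideal a2 -> integral_ideal c1 -> integral_ideal c2 ->
  integral_mx F -> integral_mx G ->
  (forall v, dsum a1 a2 v -> dsum c1 c2 (v *m G)) ->
  (forall i, dsum c1 c2 (row i (1%:M - F *m G))) ->
  idealM a1 a2 `<=` idealM c1 c2.
Proof.
move=> a1i a2i c1i c2i FO GO YG FG.
have c1m := ideal_Omod c1i; have c2m := ideal_Omod c2i.
apply: idealM_subO; first exact: idealM_Omod.
move=> y1 y2 ay1 ay2; pose D : 'M[K]_2 := mx2 y1 0 0 y2.
(* [A] is block triangular and [U] unipotent, so [A *m U] has determinant y1 y2; its last two
   columns consist of D G and 1 - F G, whose rows lie in c1 (+) c2. *)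
pose A : 'M[K]_(2 + 2) := block_mx D 0 (- F) 1%:M.
pose U : 'M[K]_(2 + 2) := block_mx 1%:M G 0 1%:M.
have detAU : \det (A *m U) = y1 * y2.
  by rewrite det_mulmx det_lblock det_ublock !det1 det_mx2; ring.
have AUE : A *m U = block_mx D (D *m G) (- F) (1%:M - F *m G).
  by rewrite mulmx_block !mulmx1 !mul0mx !mulmx0 !addr0 mulNmx [- _ + _]addrC.
have DO : integral_mx D.
  by apply/integral_mx2; split; try exact: O0; [exact: ideal_O ay1 | exact: ideal_O ay2].
have DG i : dsum c1 c2 (row i (D *m G)).
  rewrite row_mul; apply: YG; case: (ord2P i) => ->; split; rewrite !mxE //=; apply: Omod0; exact: ideal_Omod.
have entry (i : 'I_(2 + 2)) (j : 'I_2) : (A *m U) i (rshift 2 j) =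
   match fintype.split i with inl k => (D *m G) k j | inr k => (1%:M - F *m G) k j end.
  rewrite AUE -[i in LHS](splitK i); case: fintype.split => k /=.
    by rewrite block_mxEur.
  by rewrite block_mxEdr.
rewrite -detAU; apply: (@det_ideal_mem _ _ (rshift 2 0) (rshift 2 1)) => //.
- move=> i j; apply: (integral_mulmx _ _ i j) => {}i {}j.
    rewrite /A -(splitK i) -(splitK j); case: (fintype.split i) => k; case: (fintype.split j) => l /=.
    + by rewrite block_mxEul; exact (DO _ _).
    + by rewrite block_mxEur mxE; exact: O0.
    + by rewrite block_mxEdl mxE; apply: ON; exact (FO _ _).
    + by rewrite block_mxEdr; exact (@integral_mx1 K 2 _ _).
  rewrite /U -(splitK i) -(splitK j); case: (fintype.split i) => k; case: (fintype.split j) => l /=.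
  + by rewrite block_mxEul; exact (@integral_mx1 K 2 _ _).
  + by rewrite block_mxEur; exact (GO _ _).
  + by rewrite block_mxEdl mxE; exact: O0.
  + by rewrite block_mxEdr; exact (@integral_mx1 K 2 _ _).
- move=> i; rewrite entry; case: fintype.split => k.
    by have [+ _] := DG k; rewrite mxE.
  by have [+ _] := FG k; rewrite mxE.
- move=> i; rewrite entry; case: fintype.split => k.
    by have [_] := DG k; rewrite mxE.
  by have [_] := FG k; rewrite mxE.
Qed.

End Lattices.

(** * Sublattices of given index *)

Section Index.
Variable K : fieldExtType rat.
Implicit Types (a b p : set K) (M : set 'rV[K]_2).

Lemma dsum_vecmul (c1 c2 : set K) (v : 'rV[K]_2) (Q : 'M[K]_2) :
  Omodule c1 -> Omodule c2 -> dsum 'O_K 'O_K v -> (forall i, dsum c1 c2 (row i Q)) ->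
  dsum c1 c2 (v *m Q).
Proof.
move=> c1m c2m /integral_dsum vO QX; have := dsum_mulmx c1m c2m vO QX 0.
by congr dsum; apply/rowP => j; rewrite mxE.
Qed.

Lemma integral_row (Q : 'M[K]_2) i : integral_mx Q -> dsum 'O_K 'O_K (row i Q).
Proof. by move=> QO; split; rewrite mxE; exact (QO _ _). Qed.

(** The map f is linear only modulo a1 (+) a2. Its values on the standard basis form a matrix that
    agrees with f modulo a1 (+) a2, and preimages of the basis vectors give an inverse modulo the
    submodules; the Fitting inclusion is then applied in both directions. *)
Lemma index_ideal_unique (a1 a2 c1 c2 : set K) (g : 'M[K]_2) :
  integral_ideal a1 -> integral_ideal a2 -> integral_ideal c1 -> integral_ideal c2 ->
  GL2_integers K g ->
  quotient_isog (dsum 'O_K 'O_K) (latmul (dsum c1 c2) g) (dsum 'O_K 'O_K) (dsum a1 a2) ->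
  idealM a1 a2 = idealM c1 c2.
Proof.
move=> a1i a2i c1i c2i gG [f [fO fD fM fS]].
have gu := GL2_unit gG; have gO := GL2_integral gG; have gVO := GL2_integral (GL2_inv gG).
have a1m := ideal_Omod a1i; have a2m := ideal_Omod a2i.
have c1m := ideal_Omod c1i; have c2m := ideal_Omod c2i.
have [Y0 YD YZ] := submodule_dsum a1m a2m.
have YB u v : dsum a1 a2 u -> dsum a1 a2 v -> dsum a1 a2 (u - v).
  by move=> Yu Yv; rewrite -scaleN1r; apply: YD => //; apply: YZ => //; exact/ON/O1.
have e0O : dsum 'O_K 'O_K (rv2 (1 : K) 0) by apply/dsumE; split; [exact: O1 | exact: O0].
have e1O : dsum 'O_K 'O_K (rv2 (0 : K) 1) by apply/dsumE; split; [exact: O0 | exact: O1].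
have L0 : dsum 'O_K 'O_K (0 : 'rV[K]_2) by split; rewrite mxE; exact: O0.
have f0 : dsum a1 a2 (f 0).
  have := fD 1 0 0 (O1 K) L0 L0; rewrite scaler0 addr0 scale1r opprD addrA subrr sub0r.
  by move=> /(YZ (-1) _ (ON (O1 K))); rewrite scaleN1r opprK.
pose F := mx2 (f (rv2 1 0) 0 0) (f (rv2 1 0) 0 1) (f (rv2 0 1) 0 0) (f (rv2 0 1) 0 1).
have FO : integral_mx F.
  by apply/integral_mx2; have [? ?] := fO _ e0O; have [? ?] := fO _ e1O.
have Fv v : dsum 'O_K 'O_K v -> dsum a1 a2 (v *m F - f v).
  move=> [v0 v1]; have vE : v = v 0 0 *: rv2 1 0 + (v 0 1 *: rv2 0 1 + 0).
    by rewrite {1}(rv2E v); apply/rowP => j; rewrite !mxE; case: ifP => _; ring.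
  have v1O : dsum 'O_K 'O_K (v 0 1 *: rv2 0 1 + 0).
    by rewrite addr0 rv2Z; apply/dsumE; rewrite mulr0 mulr1; split=> //; exact: O0.
  have h0 := fD _ _ _ v0 e0O v1O; have h1 := fD _ _ _ v1 e1O L0.
  have vF : v *m F = v 0 0 *: f (rv2 1 0) + v 0 1 *: f (rv2 0 1).
    rewrite {1}(rv2E v) mulrv2; apply/rowP => j; rewrite !mxE.
    by case: (ord2P j) => -> /=; ring.
  have -> : v *m F - f v = - (f v - (v 0 0 *: f (rv2 1 0) + f (v 0 1 *: rv2 0 1 + 0)))
      - (f (v 0 1 *: rv2 0 1 + 0) - (v 0 1 *: f (rv2 0 1) + f 0)) - f 0.
    by rewrite vF; apply/rowP => j; rewrite !mxE; ring.
  apply: (YB) => //; apply: (YB) => //; rewrite -[- _]scaleN1r; apply: YZ; first exact/ON/O1.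
  by rewrite {1}vE.
(* Composing with g replaces the submodule [latmul (dsum c1 c2) g] by c1 (+) c2. *)
pose F' := g *m F; have F'O : integral_mx F' by exact: integral_mulmx.
have XL v : dsum c1 c2 v -> dsum 'O_K 'O_K v by move=> [? ?]; split; [exact: (ideal_O c1i) | exact: (ideal_O c2i)].
have YL v : dsum a1 a2 v -> dsum 'O_K 'O_K v by move=> [? ?]; split; [exact: (ideal_O a1i) | exact: (ideal_O a2i)].
have Lmul v Q : dsum 'O_K 'O_K v -> integral_mx Q -> dsum 'O_K 'O_K (v *m Q).
  by move=> /integral_dsum vO QO; apply/integral_dsum; exact: integral_mulmx.
have XY v : dsum 'O_K 'O_K v -> dsum c1 c2 v <-> dsum a1 a2 (v *m F').
  move=> vL; have vgL := Lmul _ _ vL gO; rewrite /F' mulmxA.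
  have -> : dsum c1 c2 v <-> latmul (dsum c1 c2) g (v *m g).
    by rewrite latmul_GL2 // mulmxK.
  rewrite -fM //; have h := Fv _ vgL; split=> h'.
    by have := YD _ _ h h'; rewrite subrK.
  by have := YB _ _ h' h; rewrite subKr.
have [u0 u0L u0Y] := fS _ e0O; have [u1 u1L u1Y] := fS _ e1O.
pose G := mx2 (u0 0 0) (u0 0 1) (u1 0 0) (u1 0 1) *m invmx g.
have GO : integral_mx G.
  apply: integral_mulmx => //; apply/integral_mx2.
  by case: u0L => ? ?; case: u1L => ? ?.
have GF : forall i, dsum a1 a2 (row i (1%:M - G *m F')).
  move=> i; rewrite linearB /= /G /F' -mulmxA mulKmx // row_mul.
  have h (e u : 'rV[K]_2) : dsum 'O_K 'O_K u -> dsum a1 a2 (e - f u) -> dsum a1 a2 (e - u *m F).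
    move=> uL eu; have -> : e - u *m F = (e - f u) - (u *m F - f u) by rewrite opprB addrA subrK.
    by apply: YB => //; exact: Fv.
  by case: (ord2P i) => ->; rewrite -mx2_1 ?row0_mx2 ?row1_mx2 -?rv2E; exact: h.
have YX v : dsum a1 a2 v -> dsum c1 c2 (v *m G).
  move=> Yv; have vL := YL _ Yv; apply/XY; first exact: Lmul.
  have -> : v *m G *m F' = v - v *m (1%:M - G *m F') by rewrite mulmxBr mulmx1 subKr -mulmxA.
  by apply: YB => //; exact: dsum_vecmul.
have FG i : dsum c1 c2 (row i (1%:M - F' *m G)).
  apply/XY.
    apply: integral_row => k l; rewrite mxE [X in _ + X]mxE; apply: OB; first exact (@integral_mx1 K 2 _ _).
    exact (integral_mulmx F'O GO _ _).
  rewrite -row_mul mulmxBl mul1mx -mulmxA -[X in X - _]mulmx1 -mulmxBr.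
  exact: dsum_mulmx.
apply/seteqP; split; first exact: (@fitting_sub _ a1 a2 c1 c2 F' G).
apply: (@fitting_sub _ c1 c2 a1 a2 G F') => //.
by move=> v Xv; apply/XY => //; exact: XL.
Qed.

(** Write 1 as the sum of u_i v_i with u_i in [a] and v_i in a^-1; then x is the sum of (v_i x) u_i,
    with integral coefficients. *)
Lemma ideal_generators a : integral_ideal a -> exists n (u : 'cV[K]_n),
  (forall i, a (u i 0)) /\ forall x, a x -> exists2 w : 'rV[K]_n, integral_mx w & w *m u = x%:M.
Proof.
move=> ai; have am := ideal_Omod ai; have : idealM a (idealV a) 1 by rewrite idealMV //; exact: O1.
move=> [n [u [v [ua va E]]]]; exists n, (\col_i u i); split=> [i|x ax]; first by rewrite mxE.
exists (\row_i (v i * x)); first by move=> i j; rewrite mxE; exact: va.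
apply/matrixP => i j; rewrite !ord1 !mxE eqxx mulr1n -[RHS]mul1r E mulr_suml.
by apply: eq_bigr => k _; rewrite !mxE; ring.
Qed.

Lemma is_lattice_dsum (c1 c2 : set K) (g : 'M[K]_2) :
  integral_ideal c1 -> integral_ideal c2 -> GL2_integers K g ->
  is_lattice (latmul (dsum c1 c2) g).
Proof.
move=> c1i c2i gG; have gu := GL2_unit gG.
have c1m := ideal_Omod c1i; have c2m := ideal_Omod c2i.
have [n1 [u1 [u1c u1g]]] := ideal_generators c1i.
have [n2 [u2 [u2c u2g]]] := ideal_generators c2i.
pose U : 'M[K]_(n1 + n2, 1 + 1) := block_mx u1 0 0 u2.
have row2 (x y : K) : row_mx (x%:M : 'M_1) (y%:M : 'M_1) = rv2 x y.
  apply/rowP => j; rewrite -(splitK j); case: (fintype.split j) => k /=; rewrite ord1.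
    by rewrite row_mxEl !mxE.
  by rewrite row_mxEr !mxE.

exists (n1 + n2)%N, (U *m g); split.
  have [x1 c1x x10] : exists2 x, c1 x & x != 0 by case: c1i.
  have [x2 c2x x20] : exists2 x, c2 x & x != 0 by case: c2i.
  have [w1 _ w1E] := u1g _ c1x; have [w2 _ w2E] := u2g _ c2x.
  pose W : 'M[K]_(1 + 1, n1 + n2) := block_mx (x1^-1 *: w1) 0 0 (x2^-1 *: w2).
  have WU : W *m U = 1%:M.
    rewrite /W /U mulmx_block !mulmx0 !mul0mx !addr0 add0r -!scalemxAl w1E w2E.
    by rewrite !scale_scalar_mx !mulVf // -scalar_mx_block.
  apply/row_fullP; exists (invmx g *m (W : 'M_(2, _))).
  by rewrite -mulmxA (mulmxA _ U) (WU : (W : 'M_(2, _)) *m (U : 'M_(_, 2)) = 1%:M) mul1mx mulVmx.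
apply/seteqP; split=> [_ [v [v0 v1] <-]|_ [w wO <-]].
  have [w1 w1O w1E] := u1g _ v0; have [w2 w2O w2E] := u2g _ v1.
  exists (row_mx w1 w2).
    by move=> i j; rewrite mxE; case: fintype.split => k; [exact (w1O _ _) | exact (w2O _ _)].
  by rewrite mulmxA mul_row_block !mulmx0 addr0 add0r w1E w2E row2 -rv2E.
exists (w *m U); last by rewrite mulmxA.
have wE k (c : set K) (u : 'cV[K]_k) (w' : 'rV[K]_k) : Omodule c -> (forall i, c (u i 0)) ->
    integral_mx w' -> c ((w' *m u) 0 0).
  move=> cm uc w'O; rewrite mxE; apply: Omod_sum => // i _; apply: OmodM => //; exact (w'O _ _).
have -> : w *m U = rv2 ((lsubmx w *m u1) 0 0) ((rsubmx w *m u2) 0 0).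
  rewrite -{1}(hsubmxK w) mul_row_block !mulmx0 addr0 add0r -row2.
  by rewrite -!mx11_scalar.
apply/dsumE; split; apply: wE => // i j; rewrite mxE; exact (wO _ _).
Qed.

Lemma has_index_dsum (c1 c2 : set K) (g : 'M[K]_2) :
  integral_ideal c1 -> integral_ideal c2 -> GL2_integers K g ->
  has_index_ideal (dsum 'O_K 'O_K) (latmul (dsum c1 c2) g) (idealM c1 c2).
Proof.
move=> c1i c2i gG; have gu := GL2_unit gG; have c1m := ideal_Omod c1i; have c2m := ideal_Omod c2i.
have [Y0 _ _] := submodule_dsum c1m c2m.
have gVO := GL2_integral (GL2_inv gG); have gO := GL2_integral gG.
exists c1, c2; split=> //; exists (fun v => v *m invmx g); split.
- by move=> v /integral_dsum vO; apply/integral_dsum; exact: integral_mulmx.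
- by move=> c u v _ _ _; rewrite mulmxDl -scalemxAl subrr.
- by move=> v _; rewrite latmul_GL2.
- move=> x /integral_dsum xO; exists (x *m g); first by apply/integral_dsum; exact: integral_mulmx.
  by rewrite mulmxK // subrr.
Qed.

Lemma latmulM M (g h : 'M[K]_2) : latmul (latmul M g) h = latmul M (g *m h).
Proof.
apply/seteqP; split=> [_ [_ [v Mv <-] <-]|_ [v Mv <-]]; first by exists v; rewrite ?mulmxA.
by exists (v *m g); [exists v | rewrite mulmxA].
Qed.

Lemma latmul_sub_dsum (c1 c2 : set K) (g : 'M[K]_2) : 
  integral_ideal c1 -> integral_ideal c2 -> GL2_integers K g ->
  latmul (dsum c1 c2) g `<=` dsum 'O_K 'O_K.
Proof.
move=> c1i c2i gG _ [v [v0 v1] <-]; apply/integral_dsum; apply: integral_mulmx; last exact: GL2_integral.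
by apply/integral_dsum; split; [exact: ideal_O v0 | exact: ideal_O v1].
Qed.

Lemma sublattice_form (b : set K) M :
  sublattices_of_index (dsum 'O_K 'O_K) b M <->
  exists (b1 b2 : set K) g, [/\ integral_ideal b1, integral_ideal b2, GL2_integers K g,
    M = latmul (dsum (idealM b1 b2) b2) g & b = idealM b1 (idealM b2 b2)].
Proof.
split=> [[_ ML [a1 [a2 [a1i a2i iso ->]]]]|[b1 [b2 [g [b1i b2i gG -> ->]]]]]; last first.
  have bbi := idealM_ideal b1i b2i; split; first exact: is_lattice_dsum.
    exact: latmul_sub_dsum.
  by rewrite idealMA; exact: has_index_dsum.
have [f [fO fD fM fS]] := iso.
have a1m := ideal_Omod a1i; have a2m := ideal_Omod a2i.
have [Y0 YD YZ] := submodule_dsum a1m a2m.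
have L0 : dsum 'O_K 'O_K (0 : 'rV[K]_2) by split; rewrite mxE; exact: O0.
have [_ LD LZ] := submodule_dsum (@Omod_O K) (@Omod_O K).
have f0 : dsum a1 a2 (f 0).
  have := fD 1 0 0 (O1 K) L0 L0; rewrite scaler0 addr0 scale1r opprD addrA subrr sub0r.
  by move=> /(YZ (-1) _ (ON (O1 K))); rewrite scaleN1r opprK.
have M0 : M 0 by apply/fM.
have MC c u v : 'O_K c -> M u -> M v -> M (c *: u + v).
  move=> cO Mu Mv; have uL := ML _ Mu; have vL := ML _ Mv.
  apply/fM; first by apply: LD => //; exact: LZ.
  rewrite -(subrK (c *: f u + f v) (f _)); apply: (YD); first exact: fD.
  by apply: YD; [apply: YZ => // ; exact/fM | exact/fM].
have Mm : submodule M.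
  split=> // [u v Mu Mv|c u cO Mu]; first by rewrite -[u]scale1r; apply: MC => //; exact: O1.
  by rewrite -[_ *: _]addr0; exact: MC.
have bi := idealM_ideal a1i a2i.
have [m bm m0] : exists2 m, idealM a1 a2 m & m != 0 by case: bi.
have mO := ideal_O bi bm.
(* The quotient L/M is killed by a1 a2, so a nonzero m in this ideal gives m L inside M, as the
   normal form requires. *)
have mM v : dsum 'O_K 'O_K v -> M (m *: v).
  move=> vL; rewrite -[_ *: _]addr0; apply/fM; first by apply: LD => //; exact: LZ.
  rewrite -(subrK (m *: f v + f 0) (f _)); apply: (YD); first exact: fD.
  apply: YD => //; have [fv0 fv1] := fO _ vL.
  by split; rewrite mxE mulrC; apply: OmodM => //; [exact: (idealM_subl a1i a2i) | exact: (idealM_subr a1i a2i)].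
have [b1 [b2 [g [b1i b2i gG ME]]]] := lattice_elementary_divisors Mm ML mO m0 mM.
exists b1, b2, g; split=> //; rewrite idealMA.
by apply: (index_ideal_unique a1i a2i _ b2i gG) => //; [exact: idealM_ideal | rewrite -ME].
Qed.

Lemma Gamma0_inv (c : set K) h : integral_ideal c -> Gamma0 c h -> Gamma0 c (invmx h).
Proof.
move=> ci [hG ch]; split; first exact: GL2_inv.
have hu := GL2_unit hG; have cm := ideal_Omod ci; set N := invmx h.
have E0 : N 1 0 * h 0 0 + N 1 1 * h 1 0 = 0 by rewrite -mulmx_entry mulVmx // mxE.
have E1 : N 1 0 * h 0 1 + N 1 1 * h 1 1 = 1 by rewrite -mulmx_entry mulVmx // mxE.
have d0 : \det h != 0 by rewrite -unitfE -unitmxE.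
have -> : N 1 0 = - (\det h)^-1 * h 1 0.
  rewrite -[LHS](mulfK d0); have -> : N 1 0 * \det h = - h 1 0; last ring.
  rewrite {1}(mx2E h) det_mx2.
  have -> : N 1 0 * (h 0 0 * h 1 1 - h 0 1 * h 1 0) =
    (N 1 0 * h 0 0 + N 1 1 * h 1 0) * h 1 1 - h 1 0 * (N 1 0 * h 0 1 + N 1 1 * h 1 1) by ring.
  by rewrite E0 E1; ring.
by apply: OmodM => //; apply: ON; exact: GL2_det_unit.
Qed.

(** The lower left entry carries c2 into the first summand, which costs exactly the factor c1; the
    inverse of h gives the other inclusion. *)
Lemma Gamma0_stable (c1 c2 : set K) h : integral_ideal c1 -> integral_ideal c2 ->
  Gamma0 c1 h -> latmul (dsum (idealM c1 c2) c2) h = dsum (idealM c1 c2) c2.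
Proof.
move=> c1i c2i hG; have c2m := ideal_Omod c2i; have hu := GL2_unit hG.1.
have cci := idealM_ideal c1i c2i; have ccm := ideal_Omod cci.
have sub k : Gamma0 c1 k -> latmul (dsum (idealM c1 c2) c2) k `<=` dsum (idealM c1 c2) c2.
  move=> [kG ck] _ [v [v0 v1] <-]; have kO := GL2_integral kG; split; rewrite mxE sum2E.
    apply: OmodD => //; first by rewrite mulrC; apply: OmodM => //; exact (kO _ _).
    by rewrite mulrC; exact: idealM_mem.
  apply: OmodD => //; rewrite mulrC; apply: OmodM => //; try exact (kO _ _).
  exact: (idealM_subr c1i c2i).
apply/seteqP; split; first exact: sub.
move=> v hv; apply/latmul_GL2 => //; apply: (sub (invmx h)); first exact: Gamma0_inv.
by exists v.
Qed.

(** The transition matrix d maps (0, y) with y in c2 into c2' (+) c2', which is stable under d^-1,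
    whence y is in c2'. When the ideals agree, the first coordinate [y * d 1 0] lies in c1 c2 for
    all y in c2, and cancelling c2 puts [d 1 0] in c1. *)
Lemma dsum_transport (c1 c2 c1' c2' : set K) g g' :
  integral_ideal c1 -> integral_ideal c2 -> integral_ideal c1' -> integral_ideal c2' ->
  GL2_integers K g -> GL2_integers K g' ->
  latmul (dsum (idealM c1 c2) c2) g = latmul (dsum (idealM c1' c2') c2') g' ->
  c2 = c2' /\ (c1 = c1' -> Gamma0 c1 (g *m invmx g')).
Proof.
have step (e1 e2 e1' e2' : set K) k k' : integral_ideal e1 -> integral_ideal e2 ->
    integral_ideal e1' -> integral_ideal e2' -> GL2_integers K k -> GL2_integers K k' ->
    latmul (dsum (idealM e1 e2) e2) k = latmul (dsum (idealM e1' e2') e2') k' ->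
    e2 `<=` e2' /\ (e1 = e1' -> e2 = e2' -> Gamma0 e1 (k *m invmx k')).
  move=> e1i e2i e1'i e2'i kG k'G E.
  have ku := GL2_unit kG; have k'u := GL2_unit k'G.
  have e2'm := ideal_Omod e2'i; have dG := GL2_mul kG (GL2_inv k'G).
  pose d := k *m invmx k'.
  have dy y : e2 y -> dsum (idealM e1' e2') e2' (rv2 0 y *m d).
    move=> ey; rewrite /d mulmxA; apply/latmul_GL2 => //; rewrite -E.
    by exists (rv2 0 y) => //; apply/dsumE; split=> //; exact: idealM0.
  split=> [y ey|e11 e22].
    have [h0 h1] := dy y ey; have h0' := idealM_subr e1'i e2'i h0.
    have : dsum e2' e2' (rv2 0 y *m d *m invmx d).
      have dVO := GL2_integral (GL2_inv dG); split; rewrite mxE sum2E; apply: OmodD => //;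
      by rewrite mulrC; apply: OmodM => //; exact (dVO _ _).
    by rewrite mulmxK; [case/dsumE | exact: GL2_unit].
  split=> //; rewrite -/d.
  suff : principal_ideal (d 1 0) `<=` e1 by apply; exact: principal_mem.
  apply: (idealM_subI e2i); [exact: principal_Omod | exact: ideal_Omod|].
  apply: idealM_subO; first exact/idealM_Omod/ideal_Omod.
  move=> y _ ey [t tO <-]; have [+ _] := dy y ey.
  rewrite mxE sum2E !mxE /= mul0r add0r -e11 -e22 idealMC => h.
  rewrite mulrCA; apply: OmodM => //; exact/idealM_Omod/ideal_Omod.
move=> c1i c2i c1'i c2'i gG g'G E.
have [s1 h] := step _ _ _ _ _ _ c1i c2i c1'i c2'i gG g'G E.
have [s2 _] := step _ _ _ _ _ _ c1'i c2'i c1i c2i g'G gG (esym E).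
have cc : c2 = c2' by apply/seteqP.
by split=> // c11; exact: h.
Qed.

Lemma ideal_scale_dsum a (c1 c2 : set K) (g : 'M[K]_2) :
  integral_ideal a -> integral_ideal c1 -> integral_ideal c2 ->
  ideal_scale a (latmul (dsum c1 c2) g) = latmul (dsum (idealM a c1) (idealM a c2)) g.
Proof.
move=> ai c1i c2i; have c1m := ideal_Omod c1i; have c2m := ideal_Omod c2i.
have am := ideal_Omod ai.
have [S0 SD SZ] := submodule_dsum (idealM_Omod c1 am) (idealM_Omod c2 am).
apply/seteqP; split.
  move=> _ [n [u [v [ua vM ->]]]].
  elim/big_ind: _ => [|x y [x' Sx <-] [y' Sy <-]|i _]; first by exists 0; rewrite ?mul0mx.
    by exists (x' + y'); [exact: SD | rewrite mulmxDl].
  have [w [w0 w1] <-] := vM i; exists (u i *: w); last by rewrite scalemxAl.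
  by split; rewrite mxE; exact: idealM_mem.
have scD x y : ideal_scale a (latmul (dsum c1 c2) g) x ->
    ideal_scale a (latmul (dsum c1 c2) g) y -> ideal_scale a (latmul (dsum c1 c2) g) (x + y).
  move=> [n [u [v [ua vb ->]]]] [m [u' [v' [ua' vb' ->]]]].
  exists (n + m)%N,
    (fun i => match fintype.split i with inl j => u j | inr j => u' j end),
    (fun i => match fintype.split i with inl j => v j | inr j => v' j end).
  split=> [i|i|]; try by case: fintype.split.
  rewrite big_split_ord /=; congr (_ + _); apply: eq_bigr => i _.
    by have := @unsplitK n m (inl i) => /= ->.
  by have := @unsplitK n m (inr i) => /= ->.
have sc0 : ideal_scale a (latmul (dsum c1 c2) g) 0.
  by exists 0%N, (fun=> 0), (fun=> 0); split=> [[]|[]|] //; rewrite big_ord0.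
have scM x v : a x -> dsum c1 c2 v -> ideal_scale a (latmul (dsum c1 c2) g) (x *: v *m g).
  move=> ax cv; exists 1%N, (fun=> x), (fun=> v *m g); split=> // [i|]; first by exists v.
  by rewrite big_ord1 scalemxAl.
move=> _ [v [v0 v1] <-].
have -> : v = rv2 (v 0 0) 0 + rv2 0 (v 0 1).
  by rewrite {1}(rv2E v) rv2D addr0 add0r.
rewrite mulmxDl; apply: (scD).
  move: (v 0 0) v0; apply: idealM_sub.
  - by rewrite rv2_0 mul0mx.
  - move=> x y hx hy; have -> : rv2 (x + y) 0 = rv2 x 0 + rv2 y 0 :> 'rV[K]_2.
      by rewrite rv2D addr0.
    by rewrite mulmxDl; exact: scD.
  - move=> x y ax cy; have -> : rv2 (x * y) 0 = x *: rv2 y 0 by rewrite rv2Z mulr0.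
    by apply: scM => //; apply/dsumE; split=> //; exact: Omod0.
move: (v 0 1) v1; apply: idealM_sub.
- by rewrite rv2_0 mul0mx.
- move=> x y hx hy; have -> : rv2 0 (x + y) = rv2 0 x + rv2 0 y :> 'rV[K]_2.
    by rewrite rv2D addr0.
  by rewrite mulmxDl; exact: scD.
- move=> x y ax cy; have -> : rv2 0 (x * y) = x *: rv2 0 y by rewrite rv2Z mulr0.
  by apply: scM => //; apply/dsumE; split=> //; exact: Omod0.
Qed.

(** The rows of g lie in the lattice of g', so the transition matrix is integral, and by symmetry so
    is its inverse. *)
Lemma latmul_eq_GL2 (g g' : 'M[K]_2) : g \in unitmx -> g' \in unitmx ->
  latmul (dsum 'O_K 'O_K) g = latmul (dsum 'O_K 'O_K) g' -> GL2_integers K (g *m invmx g').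
Proof.
move=> gu g'u E.
have int (k k' : 'M[K]_2) : k' \in unitmx ->
    latmul (dsum 'O_K 'O_K) k = latmul (dsum 'O_K 'O_K) k' -> integral_mx (k *m invmx k').
  move=> k'u Ek i j; have := row_mul i k (invmx k') => /rowP /(_ j); rewrite mxE => ->.
  have : latmul (dsum 'O_K 'O_K) k' (row i k).
    rewrite -Ek; exists (row i 1%:M); first by apply: integral_row; exact: integral_mx1.
    by rewrite -row_mul mul1mx.
  by move=> /(latmul_GL2 _ _ k'u) /integral_dsum; exact.
apply/GL2P; exists (g' *m invmx g); split; [exact: int | exact: int|].
by rewrite mulmxA mulmxKV // mulmxV.
Qed.

End Index.

(** * The matrices g_i *)

Lemma card_fset_set_seq (T : choiceType) (s : seq T) : uniq s ->
  #|` fset_set [set` s] | = size s.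
Proof.
move=> us; rewrite -[in RHS](undup_id us) -card_fseq; congr #|` _ |.
by apply/fsetP => x; rewrite in_fset_set ?inE ?mem_setE //; exact: finite_seq.
Qed.

Lemma hecke_TT_sum (K : fieldExtType rat) (a : set K) (n : nat) (M : 'I_n -> set 'rV[K]_2) :
  hecke_TT a (\sum_(i < n) single (M i)) = \sum_(i < n) single (ideal_scale a (M i)).
Proof.
pose F := fun L : set 'rV[K]_2 => single (ideal_scale a L).
have addF := lift_is_additive F.
have F0 : fglift F 0 = 0 by have := addF 0 0; rewrite subr0 subrr.
have FD x y : fglift F (x + y) = fglift F x + fglift F y.
  by have := addF (x + y) y; rewrite addrK => ->; rewrite subrK.
rewrite /hecke_TT -/F (big_morph _ FD F0); apply: eq_bigr => i _.
by rewrite /single liftU scale1r.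
Qed.

Section Main.
Variables (K : fieldExtType rat) (a b : set K) (beta : K).
Hypotheses (ai : integral_ideal a) (bi : integral_ideal b)
  (abE : idealM (idealX a 2) b = principal_ideal beta).

Local Notation L := (dsum 'O_K 'O_K).

Variables (B : set K * set K -> 'M[K]_2) (S : set K * set K -> seq 'M[K]_2).
Hypothesis BP : forall f, sq_factorizations b f ->
  ideal_pair_mx (idealM a (idealM f.1 f.2)) (idealM a f.2) (B f) /\ \det (B f) = beta.
Hypothesis SP : forall f, sq_factorizations b f ->
  [/\ uniq (S f), (size (S f))%:R = psi f.1,
    right_coset_reps (Gamma0 f.1) (GL2_integers K) [set` S f]
    & forall t, t \in S f -> \det t = 1].

Lemma beta_neq0 : beta != 0.
Proof.
have : integral_ideal (principal_ideal beta).
  by rewrite -abE; apply: idealM_ideal => //; exact: idealX_ideal.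
case=> _ _ _ _ [x [c cO <-] +]; by rewrite mulf_eq0 negb_or => /andP[].
Qed.

Lemma sq_ideals f : sq_factorizations b f ->
  [/\ integral_ideal f.1, integral_ideal f.2, integral_ideal (idealM a f.2)
    & idealM a (idealM f.1 f.2) = idealM f.1 (idealM a f.2)].
Proof. by case=> f1 f2 _; split=> //; [exact: idealM_ideal | exact: idealMCA]. Qed.

Lemma rep_GL2 f t : sq_factorizations b f -> t \in S f -> GL2_integers K t.
Proof. by move=> /SP[_ _ [sub _] _] tS; exact: sub. Qed.

Lemma rep_lattice f t : sq_factorizations b f ->
  latmul L (B f *m t) = latmul (dsum (idealM f.1 (idealM a f.2)) (idealM a f.2)) t.
Proof.
move=> ff; have [[_ BL] _] := BP ff; have [_ _ _ <-] := sq_ideals ff.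
by rewrite -latmulM BL.
Qed.

(** The lattice determines a b2, hence b2, then b1 by cancelling b2^2 in b, and finally the coset of
    t. Both the matrices and their lattices are therefore distinct. *)
Lemma rep_unique f f' t t' : sq_factorizations b f -> sq_factorizations b f' ->
  t \in S f -> t' \in S f' -> latmul L (B f *m t) = latmul L (B f' *m t') ->
  f = f' /\ t = t'.
Proof.
move=> ff ff' tS tS'; rewrite !rep_lattice // => E.
have [f1i f2i af2i _] := sq_ideals ff; have [f1i' f2i' af2i' _] := sq_ideals ff'.
have [e2 h] := dsum_transport f1i af2i f1i' af2i' (rep_GL2 ff tS) (rep_GL2 ff' tS') E.
have {}e2 : f.2 = f'.2 by apply: (idealM_inj ai) e2; exact: ideal_Omod.
have e1 : f.1 = f'.1.
  move: ff ff' => /sq_factorizationE[_ _ bE] /sq_factorizationE[_ _ bE'].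
  apply: (idealM_inj (idealM_ideal f2i f2i)); try exact: ideal_Omod.
  by rewrite [LHS]idealMC [RHS]idealMC -bE bE' e2.
have fE : f = f' by case: f f' e1 e2 {ff ff' tS tS' E f1i f2i af2i f1i' f2i' af2i' h} => [? ?] [? ?] /= -> ->.
split=> //; subst f'; have [_ _ [_ P] _] := SP ff.
have [u [_ uu]] := P t (rep_GL2 ff tS).
rewrite -(uu t); last by split=> //; exists 1%:M; [exact: Gamma0_1 | rewrite mul1mx].
rewrite -(uu t') //; split=> //; exists (t *m invmx t'); first exact: h.
by rewrite mulmxKV //; exact/GL2_unit/(rep_GL2 ff).
Qed.

Lemma rep_exists f g : sq_factorizations b f -> GL2_integers K g ->
  exists2 t, t \in S f & exists2 h, Gamma0 f.1 h & h *m t = g.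
Proof.
by move=> ff gG; have [_ _ [_ P] _] := SP ff; have [t [[tS h] _]] := P g gG; exists t.
Qed.

Definition reps : seq 'M[K]_2 :=
  [seq B f *m t | f <- fset_set (sq_factorizations b), t <- S f].

Let finsq := finite_sq_factorizations bi.

Lemma repsP g : g \in reps <->
  exists f t, [/\ sq_factorizations b f, t \in S f & g = B f *m t].
Proof.
have inF f : (f \in fset_set (sq_factorizations b)) <-> sq_factorizations b f.
  by rewrite in_fset_set // inE.
split=> [/allpairsPdep[f [t [/inF ff tS ->]]]|[f [t [/inF ff tS ->]]]]; first by exists f, t.
by apply/allpairsPdep; exists f, t.
Qed.

Lemma uniq_reps : uniq reps.
Proof.
apply: allpairs_uniq_dep; first exact: fset_uniq.
  by move=> f; rewrite in_fset_set // inE => /SP[].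
move=> _ _ /allpairsPdep[x [y [xF yS ->]]] /allpairsPdep[x' [y' [xF' yS' ->]]] /= E.
move: xF xF'; rewrite !in_fset_set // !inE => xF xF'.
by have [] := rep_unique xF xF' yS yS' (congr1 (latmul L) E) => xx yy; subst x' y'.
Qed.

Lemma size_reps : size reps = eta b.
Proof.
apply/eqP; rewrite -(eqr_nat rat) -(psisum_eta bi) /psisum fsbig_finite //.
rewrite size_allpairs_dep sumnE big_map natr_sum; apply/eqP.
apply: eq_big_seq => f; rewrite in_fset_set // inE => /SP[_ <-] //.
Qed.

End Main.

(** In the last clause the permutation depends on [gamma]: as [gamma] varies, [g i *m gamma] meets
    every left multiple set of [GL2_integers K] that comes from the factorization of [g i], so no
    single permutation would serve once some psi(b1) exceeds 1. *)
Theorem lemma7p1 (K : fieldExtType rat) (a b : set K) (beta : K)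
    (ha : integral_ideal a) (hb : integral_ideal b)
    (hab : idealM (idealX a 2) b = principal_ideal beta) :
  exists g : 'I_(eta b) -> 'M[K]_2,
    [/\ injective g /\ (forall i, \det (g i) = beta),
        hecke_TT a (hecke_T b (single (dsum 'O_K 'O_K)))
          = \sum_(i < eta b) single (latmul (dsum 'O_K 'O_K) (g i)),
        (eta b)%:R = \sum_(f \in sq_factorizations b) psi f.1,
        exists (B : set K * set K -> 'M[K]_2)
               (C : set K * set K -> set 'M[K]_2),
          (forall f, sq_factorizations b f ->
             [/\ ideal_pair_mx (idealM a (idealM f.1 f.2)) (idealM a f.2) (B f)
                 /\ \det (B f) = beta,
                 right_coset_reps (Gamma0 f.1) (GL2_integers K) (C f)
                 /\ (forall c, C f c -> \det c = 1)
               & #|` fset_set [set B f *m c | c in C f] |%:R = psi f.1]) /\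
          range g = \bigcup_(f in sq_factorizations b)
                      [set B f *m c | c in C f]
      & forall gamma, GL2_integers K gamma ->
          exists s : 'S_(eta b), forall i,
            [set h *m g (s i) | h in GL2_integers K] (g i *m gamma)].
Proof.
(* Outside [sq_factorizations b] dummy values make the choice functions total. *)
have exB f : exists B, sq_factorizations b f ->
    ideal_pair_mx (idealM a (idealM f.1 f.2)) (idealM a f.2) B /\ \det B = beta.
  have [/sq_factorizationE[f1i f2i bE]|nf] := pselect (sq_factorizations b f); last by exists 0.
  have [|||C CP] := @ideal_pair_exists K (idealM a (idealM f.1 f.2)) (idealM a f.2) beta.
  - by apply: idealM_ideal => //; exact: idealM_ideal.
  - exact: idealM_ideal.
  - by rewrite -hab idealX2 1?idealMACA -1?(idealMA f.1) -?bE //; exact: ideal_Omod.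
  by exists C.
have exS f : exists s, sq_factorizations b f ->
    [/\ uniq s, (size s)%:R = psi f.1,
    right_coset_reps (Gamma0 f.1) (GL2_integers K) [set` s]
    & forall t, t \in s -> \det t = 1].
  have [/sq_factorizationE[f1i _ _]|nf] := pselect (sq_factorizations b f); last by exists [::].
  by have [s sP] := Gamma0_reps f1i; exists s.
have [B BP] := choice exB; have [S SP] := choice exS.
have szG := size_reps hb B SP; have uG := uniq_reps ha hb BP SP.
have GP := repsP hb B S; set G := reps b B S in szG uG GP.
pose L : set 'rV[K]_2 := dsum 'O_K 'O_K.
pose g (i : 'I_(eta b)) := nth 0 G i.
have gG i : g i \in G by apply: mem_nth; rewrite szG.
have gsurj x : x \in G -> exists i, g i = x.
  move=> /(nthP 0)[i lti <-]; rewrite szG in lti.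
  by exists (Ordinal lti).
have ginj : injective g.
  by move=> i j /eqP; rewrite nth_uniq ?szG // => /eqP; exact: val_inj.
have gP i : exists ft : (set K * set K) * 'M[K]_2,
    [/\ sq_factorizations b ft.1, ft.2 \in S ft.1 & g i = B ft.1 *m ft.2].
  by have /GP[f [t h]] := gG i; exists (f, t).
have [d dP] := choice gP.
have gdet i : \det (g i) = beta.
  have [ff tS ->] := dP i; have [_ Bd] := BP _ ff; have [_ _ _ Sd] := SP _ ff.
  by rewrite det_mulmx Bd Sd // mulr1.
have latinj i j : latmul L (g i) = latmul L (g j) -> i = j.
  move=> E; apply: ginj; have [ff tS gE] := dP i; have [ff' tS' gE'] := dP j.
  rewrite gE gE' in E *; by have [-> ->] := rep_unique ha BP SP ff ff' tS tS' E.
have gu i : g i \in unitmx by rewrite unitmxE gdet unitfE; exact: beta_neq0 ha hb hab.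
exists g; split=> //.
(* [M i] is the sublattice that becomes [latmul L (g i)] after multiplication by a; it is used to
   index the sublattices of index b bijectively. *)
- pose M i := latmul (dsum (idealM (d i).1.1 (d i).1.2) (d i).1.2) (d i).2.
  have Mg i : ideal_scale a (M i) = latmul L (g i).
    have [ff tS gE] := dP i; have [f1i f2i _ fE] := sq_ideals ha ff.
    by rewrite ideal_scale_dsum ?gE ?(rep_lattice ha BP) ?fE //; exact: idealM_ideal.
  rewrite /hecke_T /single liftU scale1r -/L.
  have -> : \sum_(N \in sublattices_of_index L b) single N = \sum_(i < eta b) single (M i).
    rewrite (@reindex_fsbig _ _ _ _ _ M [set` enum 'I_(eta b)]).
      by rewrite -fsbig_seq ?enum_uniq // big_enum.
    split=> [i _|i j _ _ E|N].
    - have [ff tS _] := dP i; have [f1i f2i _ _] := sq_ideals ha ff.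
      apply/sublattice_form; exists (d i).1.1, (d i).1.2, (d i).2; split=> //.
        exact: (rep_GL2 SP ff).
      by case/sq_factorizationE: ff.
    - by apply: latinj; rewrite -!Mg E.
    - move=> /sublattice_form[b1 [b2 [h [b1i b2i hG -> bE]]]].
      have ff : sq_factorizations b (b1, b2) by apply/sq_factorizationE.
      have [t tS [k kG kt]] := rep_exists SP ff hG.
      have [i gi] : exists i, g i = B (b1, b2) *m t by apply/gsurj/GP; exists (b1, b2), t.
      exists i; first by rewrite /= mem_enum.
      (* The pair [d i] was chosen independently of (b1, b2) and t; uniqueness identifies the
         two. *)
      have [ff' tS' gE] := dP i.
      have [e1 e2] := rep_unique ha BP SP ff' ff tS' tS (congr1 (latmul L) (etrans (esym gE) gi)).
      by rewrite /M e1 e2 /= -kt -latmulM (Gamma0_stable b1i b2i kG).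
  rewrite -[RHS](eq_bigr _ (fun i _ => congr1 (@single K) (Mg i))).
  exact: hecke_TT_sum.
- by rewrite -(psisum_eta hb).
- exists B, (fun f => [set` S f]); split=> [f ff|].
    have [uS sS SC Sd] := SP _ ff; split=> //; first exact: BP.
    have -> : [set B f *m c | c in [set` S f]] = [set` [seq B f *m c | c <- S f]].
      apply/seteqP; split=> [_ [c cS <-]|_ /mapP[c cS ->]]; first exact: map_f.
      by exists c.
    rewrite card_fset_set_seq ?size_map // map_inj_in_uniq // => t t' tS tS' E.
    by have [] := rep_unique ha BP SP ff ff tS tS' (congr1 (latmul L) E).
  apply/seteqP; split=> [_ [i _ <-]|x [f ff [t tS <-]]].
    by have [ff tS gE] := dP i; exists (d i).1 => //; exists (d i).2.
  have [i gi] : exists i, g i = B f *m t by apply/gsurj/GP; exists f, t.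
  by exists i.
- move=> gamma gammaG.
  have ex i : exists j, latmul L (g i *m gamma) = latmul L (g j).
    have [ff tS gE] := dP i; have [f1i f2i af2i _] := sq_ideals ha ff.
    (* The representative in [g i] times gamma equals h t with h in Gamma_0(b1), and h stabilises
       the row lattice of the factor [B]. *)
    have [t tS' [h hG ht]] := rep_exists SP ff (GL2_mul (rep_GL2 SP ff tS) gammaG).
    have [j gj] : exists j, g j = B (d i).1 *m t by apply/gsurj/GP; exists (d i).1, t.
    exists j; rewrite gE gj -mulmxA !(rep_lattice ha BP) // -ht -latmulM.
    by rewrite (Gamma0_stable f1i af2i hG).
  have [s sP] := choice ex.
  have sinj : injective s.
    move=> i j sij; apply: latinj.
    have : latmul L (g i *m gamma) = latmul L (g j *m gamma) by rewrite !sP sij.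
    move=> /(congr1 (fun M => latmul M (invmx gamma))).
    by rewrite !latmulM !mulmxK //; exact: GL2_unit.
  exists (perm sinj) => i; rewrite permE /=.
  exists (g i *m gamma *m invmx (g (s i))); last by rewrite mulmxKV ?gu.
  by apply: latmul_eq_GL2; [rewrite unitmx_mul gu GL2_unit | exact: gu | exact: sP].
Qed.
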